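(* Let $a\in M_{p\times q}(\mathbb N)$ with columns $a_1,\dots,a_q$, and let $n$ be at least the number of rows and of columns of every matrix appearing below. Then $$J_n(a)=\sum_{r\in[a]}K'_r(a)\,J_n(E'_r(a)),$$ where $K'_r(a)=\prod_{j=1}^q K_{r^j}(a_j)/\prod_{i,j}a_{ij}!!$, and for $r=(r^1,\dots,r^q)\in[a]$, with $R_{kl}=\sum_j r^j_{kl}$, the matrix $E'_r(a)$ has $p$ rows and columns grouped into blocks indexed by pairs $(k,l)$, $1\le k\le l\le p$: for $k<l$ the $(k,l)$-block consists of $R_{kl}$ columns each with entry $1$ in rows $k$ and $l$ and $0$ elsewhere; for $k=l=i$ the block is a single column with entry $R_{ii}$ in row $i$ and $0$ elsewhere.
   Context: For an integer $m\ge0$, $m!!$ denotes $(m-1)(m-3)\cdots$, the product of the positive integers $\le m-1$ with the parity of $m-1$ (empty product $=1$); so $m!!$ is the number of pairings of $m$ points when $m$ is even. $O_n$ is the orthogonal group with Haar probability measure; for $a\in M_{p\times q}(\mathbb N)$, $p,q\le n$, $I_n(a)=\int_{O_n}\prod_{i,j}u_{ij}^{a_{ij}}\,du$, and $J_n(a)$ is defined by $I_n(a)=\frac{(n-1)!!\prod_{i,j}a_{ij}!!}{(\sum_{i,j}a_{ij}+n-1)!!}J_n(a)$. For $v\in\mathbb N^p$, $[v]$ is the set of symmetric $r\in M_p(\mathbb N)$ with even diagonal and $\sum_l r_{kl}=v_k$ for all $k$. Splitting $\{1,\dots,\sum v_k\}$ into consecutive blocks $B_1,\dots,B_p$ of sizes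 $v_1,\dots,v_p$, a pairing has type $r$ if exactly $r_{kl}$ elements of $B_k$ are paired with elements of $B_l$; $K_r(v)$ is the number of pairings of type $r$, i.e. $K_r(v)=\prod_k\frac{v_k!}{\prod_l r_{kl}!}\prod_{k<l}r_{kl}!\prod_i r_{ii}!!$. For a matrix $a$ with columns $a_j$, $[a]=[a_1]\times\dots\times[a_q]$. *)

(* Defs.v *)
From HB Require Import structures.
From mathcomp Require Import all_boot all_order all_algebra.
From mathcomp Require Import all_classical all_reals all_analysis.

Set Implicit Arguments.
Unset Strict Implicit.
Unset Printing Implicit Defensive.

Import Order.TTheory GRing.Theory Num.Theory.
Import numFieldNormedType.Exports.

(* The shifted double factorial m!! = (m - 1)(m - 3)..., written (m - 1)!! in
   the usual convention; it is 1 for m = 0. *)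
Definition dfact (m : nat) : nat :=
  \prod_(1 <= k < m | odd k == odd (m - 1)) k.

Section Pairings.
Context {p : nat}.
Implicit Types (v : 'cV[nat]_p) (r : 'M[nat]_p).

Definition pair_types v : set 'M[nat]_p :=
  [set r | [/\ (r^T)%R = r, forall k, ~~ odd (r k k)
             & forall k, \sum_l r k l = v k ord0]]%classic.

Local Notation points v := ('I_(\sum_i v i ord0)).

Definition block v (k : 'I_p) : {set points v} :=
  [set x : points v | \sum_(i < p | i < k) v i ord0 <= x
                      < \sum_(i < p | i <= k) v i ord0]%SET.

Definition is_pairing (T : finType) (P : {set {set T}}) : bool :=
  finset.partition P [set: T]%SET && [forall B in P, #|B| == 2].

Definition has_type v r (P : {set {set points v}}) : bool :=
  [forall k, forall l,
     #|[set x in block v k | [exists y in block v l, [set x; y] \in P]]%SET|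
     == r k l].

(* For r in pair_types v this is the product
   \prod_k (v_k! / \prod_l r_kl!) * \prod_(k < l) r_kl! * \prod_i r_ii!!. *)
Definition Kcoef v r : nat :=
  #|[set P : {set {set points v}} | is_pairing P && has_type r P]%SET|.

End Pairings.

Section Expansion.
Context {p q : nat}.
Implicit Types (a : 'M[nat]_(p, q)) (r : {ffun 'I_q -> 'M[nat]_p}).

Definition mx_pair_types a : set {ffun 'I_q -> 'M[nat]_p} :=
  [set r | forall j, pair_types (col j a) (r j)]%classic.

Definition total_type r : 'M[nat]_p := (\sum_j r j)%R.

(* The columns of E'_r, listed block by block: the blocks are indexed by the
   pairs k <= l in lexicographic order. *)
Definition Eblock r (k l : 'I_p) : seq 'cV[nat]_p :=
  if k == l then [:: (\col_i (if i == k then total_type r k k else 0))%R]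
  else nseq (total_type r k l) (\col_i (((i == k) || (i == l)) : nat))%R.

Definition Ecols r : seq 'cV[nat]_p :=
  flatten [seq Eblock r k l
          | k : 'I_p <- enum 'I_p,
            l : 'I_p <- [seq l : 'I_p <- enum 'I_p | k <= l]].

(* E'_r(a): it depends on a only through r. *)
Definition Emx r : 'M[nat]_(p, size (Ecols r)) :=
  (\matrix_(i, j) tnth (in_tuple (Ecols r)) j i ord0)%R.

End Expansion.

(* Hence the sum over mx_pair_types a as a classical set is a genuine finite
   sum: a finitely supported sum over an infinite support would be 0. *)
Lemma finite_mx_pair_types {p q : nat} (a : 'M[nat]_(p, q)) :
  finite_set (mx_pair_types a).
Proof.
pose N := \sum_i \sum_j a i j.
pose f (s : {ffun 'I_q -> 'M['I_N.+1]_p}) : {ffun 'I_q -> 'M[nat]_p} :=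
  [ffun j => (\matrix_(k, l) (s j k l : nat))%R].
apply: (@sub_finite_set _ _ (f @` setT)%classic);
  last by apply: finite_image; exact: finite_finset.
move=> r ra /=; exists [ffun j => (\matrix_(k, l) inord (r j k l))%R] => //.
apply/ffunP => j; apply/matrixP => k l; rewrite !ffunE !mxE inordK // ltnS.
have [_ _ /(_ k) vk] := ra j.
apply: (@leq_trans (\sum_l' r j k l')); first by rewrite (bigD1 l) //= leq_addr.
rewrite vk mxE /N (bigD1 k) //= (bigD1 j) //= -addnA.
exact: leq_addr.
Qed.

Local Open Scope classical_set_scope.
Local Open Scope ring_scope.

Notation borel_mx R n := (g_sigma_algebraType (@open 'M[R]_n)).

Section OrthogonalIntegrals.
Context {R : realType} {n : nat}.

Definition orthogonal_mx : set 'M[R]_n := [set u | u *m u^T = 1%:M].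

(* The Haar probability measure of O_n, as a Borel measure on M_n(R) carried
   by O_n and invariant under left translations by O_n. *)
Definition is_haar (mu : probability (borel_mx R n) R) : Prop :=
  mu orthogonal_mx = 1%E /\
  forall (g : 'M[R]_n) (A : set (borel_mx R n)),
    orthogonal_mx g -> measurable A -> mu (mulmx g @` A) = mu A.

(* Entry of u at natural number indices; 0 outside the n x n range, which only
   occurs when the hypothesis p, q <= n of I_n(a) fails. *)
Definition entry (u : 'M[R]_n) (i j : nat) : R :=
  if (insub i, insub j) is (Some i', Some j') then u i' j' else 0.

Definition Iint (mu : probability (borel_mx R n) R) {p q : nat}
    (a : 'M[nat]_(p, q)) : R :=
  \int[mu]_(u in orthogonal_mx)
     (\prod_(i < p) \prod_(j < q) entry u i j ^+ a i j).

Definition Jint (mu : probability (borel_mx R n) R) {p q : nat}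
    (a : 'M[nat]_(p, q)) : R :=
  Iint mu a * (dfact ((\sum_i \sum_j a i j) + n - 1)%N)%:R
  / (dfact (n - 1)%N * \prod_i \prod_j dfact (a i j))%N%:R.

End OrthogonalIntegrals.

Definition Kcoef' {R : realType} {p q : nat} (a : 'M[nat]_(p, q))
    (r : {ffun 'I_q -> 'M[nat]_p}) : R :=
  (\prod_j Kcoef (col j a) (r j))%N%:R
  / (\prod_i \prod_j dfact (a i j))%N%:R.

(* Main.v *)
(* Idea. For row indices [i] and column indices [j] of a finite set [S] of
   points, the moment E(prod_s u_(i s, j s)), as a function of [j], is a linear
   combination of the indicators of [j \o sg = j] over the pairings [sg] of [S].
   Indeed, rotating two rows gives an integration by parts formula; summed over
   all the rows beyond the largest row that occurs, and combined with the
   orthogonality of the columns, it expresses the moment through moments with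
   two points fewer or with two points moved to smaller rows. Averaging over the
   permutations of [S] preserving [i] makes the coefficient of [sg] depend only
   on its type, so that I_n(b) is the sum of g(type sg) over the pairings [sg]
   compatible with the columns of b, with the same g for all b with given row
   sums.  For b = a, grouping the pairings by their types r^j on the columns
   yields the sum of prod_j K_(r^j)(a_j) g(R); for b = E'_r(a), every compatible
   pairing has type R and there are prod_i R_ii!! of them, hence
   g(R) = I_n(E'_r(a)) / prod_i R_ii!!. *)

Require Import Defs.
From HB Require Import structures.
From mathcomp Require Import all_boot all_order all_algebra.
From mathcomp Require Import all_fingroup.
From mathcomp Require Import all_classical all_reals all_analysis.
From mathcomp Require Import measurable_realfun.
From mathcomp Require Import ring lra zify.

Import Order.TTheory GRing.Theory Num.Theory.
Import numFieldNormedType.Exports.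

Local Open Scope classical_set_scope.
Local Open Scope ring_scope.

Set Implicit Arguments.
Unset Strict Implicit.
Unset Printing Implicit Defensive.

(** * Pairings as involutions *)

Section Pairings.
Local Close Scope classical_set_scope.
Local Open Scope set_scope.
Variable S : finType.
Implicit Types (A : {set S}) (sg tau : {perm S}).

(* Pairings of [A] are encoded as involutions with support [A]. *)
Definition pairing_on A sg :=
  [forall s, (sg (sg s) == s) && ((sg s != s) == (s \in A))].

Lemma pairing_onP A sg :
  reflect (involutive sg /\ forall s, (sg s != s) = (s \in A))
    (pairing_on A sg).
Proof.
apply: (iffP forallP) => [H | [invs suppA] s]; last by rewrite invs suppA !eqxx.
by split=> s; have /andP[/eqP ? /eqP ?] := H s.
Qed.

(** Composition with the transposition adds the pair of [t] and [s] to a pairing fixing both, and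
    strips it off again; inductions on pairings rest on this. *)
Lemma pairing_on_tpermM A t s tau : t != s -> t \in A -> s \in A ->
  pairing_on A (tau * tperm t s)%g && ((tau * tperm t s)%g t == s)
  = pairing_on (A :\ t :\ s) tau.
Proof.
move=> ts tA sA.
have st : (s == t) = false by rewrite eq_sym (negPf ts).
apply/andP/idP => [[/pairing_onP[inv supp] /eqP tS]|/pairing_onP[inv supp]].
  have sT : (tau * tperm t s)%g s = t by have := inv t; rewrite tS.
  have taut : tau t = t.
    by apply: (@perm_inj _ (tperm t s)); rewrite -permM tS tpermL.
  have taus : tau s = s.
    by apply: (@perm_inj _ (tperm t s)); rewrite -permM sT tpermR.
  have tauE x : x != t -> x != s -> (tau * tperm t s)%g x = tau x.
    move=> xt xs; rewrite permM tpermD // eq_sym.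
      by apply: contra_neq xt => tx; apply: (@perm_inj _ tau); rewrite tx.
    by apply: contra_neq xs => tx; apply: (@perm_inj _ tau); rewrite tx.
  apply/pairing_onP; split=> x.
    have [->|xt] := eqVneq x t; first by rewrite !taut.
    have [->|xs] := eqVneq x s; first by rewrite !taus.
    rewrite -[tau x]tauE // -[LHS]tauE ?inv //.
      by apply: contra_neq xt => /(congr1 (tau * tperm t s)%g);
        rewrite inv tS => xs'; rewrite xs' eqxx in xs.
    by apply: contra_neq xs => /(congr1 (tau * tperm t s)%g);
      rewrite inv sT => xt'; rewrite xt' eqxx in xt.
  rewrite !inE; have [->|xt] := eqVneq x t; first by rewrite taut eqxx andbF.
  have [->|xs] := eqVneq x s; first by rewrite taus eqxx.
  by rewrite -tauE // supp.
have taut : tau t = t by apply/eqP; rewrite -[_ == _]negbK supp !inE eqxx andbF.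
have taus : tau s = s by apply/eqP; rewrite -[_ == _]negbK supp !inE eqxx.
have tauE x : x != t -> x != s -> (tau * tperm t s)%g x = tau x.
  move=> xt xs; rewrite permM tpermD // eq_sym.
    by apply: contra_neq xt => tx; apply: (@perm_inj _ tau); rewrite tx.
  by apply: contra_neq xs => tx; apply: (@perm_inj _ tau); rewrite tx.
have tT : (tau * tperm t s)%g t = s by rewrite permM taut tpermL.
have sT : (tau * tperm t s)%g s = t by rewrite permM taus tpermR.
split; last by rewrite tT.
apply/pairing_onP; split=> x.
  have [->|xt] := eqVneq x t; first by rewrite tT.
  have [->|xs] := eqVneq x s; first by rewrite sT.
  rewrite tauE // tauE //.
    by apply: contra_neq xt => tx; rewrite -[x]inv tx.
  by apply: contra_neq xs => tx; rewrite -[x]inv tx.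
have [->|xt] := eqVneq x t; first by rewrite tT st tA.
have [->|xs] := eqVneq x s; first by rewrite sT ts sA.
by rewrite tauE // supp !inE xt xs.
Qed.

Lemma big_pairing_on_fiber (V : nmodType) A t s (F : {perm S} -> V) :
  t != s -> t \in A -> s \in A ->
  (\sum_(sg | pairing_on A sg && (sg t == s)) F sg =
   \sum_(tau | pairing_on (A :\ t :\ s) tau) F (tau * tperm t s)%g)%R.
Proof.
move=> ts tA sA; rewrite (reindex_inj (mulIg (tperm t s))).
by apply: eq_bigl => tau; rewrite /= pairing_on_tpermM.
Qed.

Lemma pairing_on_neq A sg t : pairing_on A sg -> t \in A -> sg t \in A :\ t.
Proof.
move=> /pairing_onP[inv supp] tA; rewrite !inE supp tA -supp inv.
by rewrite eq_sym supp.
Qed.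

Lemma pairing_on0 sg : pairing_on finset.set0 sg = (sg == 1%g).
Proof.
apply/pairing_onP/eqP => [[_ supp]|->].
  by apply/permP => s; rewrite perm1; apply/eqP;
    rewrite -[_ == _]negbK supp inE.
by split=> s; rewrite !perm1 // eqxx inE.
Qed.

Lemma dfactSS m : dfact m.+2 = (m.+1 * dfact m)%N.
Proof.
rewrite /dfact subn1 /= big_mkcond /= big_nat_recr //= -big_mkcond /=.
rewrite eqxx mulnC; congr (_ * _)%N.
(* The largest candidate left has the wrong parity and drops out; [m = 0] is apart because [m - 1]
   is truncated there, both products then being empty. *)
case: m => [|m]; first by rewrite !big_geq.
rewrite big_mkcond big_nat_recr //= -big_mkcond /=.
rewrite subn1 /=; case: (odd m) => /=; rewrite muln1;
  by apply: eq_bigl => k; case: (odd k).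
Qed.

(** A fixed [t] has [#|A| - 1] possible partners, and removing the pair leaves a pairing of two
    points fewer: this is the recursion of the shifted double factorial. *)
Lemma card_pairing_on A :
  ~~ odd #|A| -> #|[set sg | pairing_on A sg]| = dfact #|A|.
Proof.
have [m] := ubnP #|A|; elim: m A => // m IH A; rewrite ltnS => Am evenA.
have [A0|/set0Pn[t tA]] := eqVneq A finset.set0.
  rewrite A0 cards0 /dfact big_geq // -(cards1 (1%g : {perm S})).
  by apply: eq_card => sg; rewrite !inE pairing_on0.
have cA : #|A| = (#|A :\ t|.-1).+2.
  rewrite (cardsD1 t) tA /= add1n; case: #|A :\ t| (cardsD1 t A) => // cA.
  by move: evenA; rewrite cA tA.
rewrite -sum1dep_card (partition_big (fun sg : {perm S} =>
  sg t) (mem (A :\ t))); last first.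
  by move=> sg /pairing_on_neq; apply.
rewrite (eq_bigr (fun=> dfact #|A|.-2)); last first.
  move=> s; rewrite !inE => /andP[st sA].
  apply: etrans (big_pairing_on_fiber (V := nat) _ _ tA sA) _;
    rewrite 1?eq_sym //.
  apply: etrans (sum1dep_card _) _.
  have cAs : #|A :\ t :\ s| = #|A|.-2.
    by rewrite (cardsD1 t A) tA (cardsD1 s (A :\ t)) !inE st sA.
  rewrite IH ?cAs //; first by rewrite cA /= in Am *; exact: ltnW.
  by rewrite cA /= in evenA *; rewrite negbK in evenA.
have cAt : #|A :\ t| = #|A :\ t|.-1.+1.
  by apply/eqP; rewrite -eqSS -cA (cardsD1 t A) tA.
apply: etrans (sum_nat_const _ _) _; rewrite cA dfactSS /=; congr (_ * _)%N.
by rewrite -cAt; apply: eq_card => x.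
Qed.

Lemma card_pairing_on_even A sg : pairing_on A sg -> ~~ odd #|A|.
Proof.
have [m] := ubnP #|A|; elim: m A sg => // m IH A sg; rewrite ltnS => Am psg.
have [->|/set0Pn[t tA]] := eqVneq A finset.set0; first by rewrite cards0.
have := pairing_on_neq psg tA; rewrite !inE => /andP[st sA].
have := @pairing_on_tpermM A t (sg t) (sg * tperm t (sg t))%g.
rewrite eq_sym st tA sA -mulgA tperm2 mulg1 psg eqxx =>
  /(_ isT isT isT)/esym psg'.
have cA : #|A| = #|A :\ t :\ sg t|.+2.
  by rewrite (cardsD1 t A) tA (cardsD1 (sg t) (A :\ t)) !inE st sA.
have := IH _ _ _ psg'; rewrite cA /= negbK; apply.
by rewrite cA in Am; exact: leq_trans Am.
Qed.

End Pairings.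

(** * Conjugacy of pairings of the same type *)

Section Transitivity.
Local Close Scope classical_set_scope.
Local Open Scope set_scope.
Variables (S : finType) (L : eqType) (i : S -> L).
Implicit Types (sg tau pi : {perm S}).

Definition same_type sg tau := forall k l,
  #|[set s | (i s == k) && (i (sg s) == l)]| =
  #|[set s | (i s == k) && (i (tau s) == l)]|.

Lemma pairing_onJ sg pi : pairing_on [set: S] sg ->
  pairing_on [set: S] (sg ^ pi)%g.
Proof.
move=> /pairing_onP[inv supp]; apply/pairing_onP; split=> s;
  rewrite -[s](permKV pi).
  by rewrite !permJ inv.
by rewrite permJ (inj_eq perm_inj) supp !inE.
Qed.

Lemma same_typeJ sg tau pi : (forall s, i (pi s) = i s) -> same_type sg tau ->
  same_type (sg ^ pi)%g tau.
Proof.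
move=> ipi st k l; rewrite -st -[RHS](card_imset _ (@perm_inj _ pi)).
apply: eq_card => s; rewrite -[s](permKV pi) mem_imset; last exact: perm_inj.
by rewrite !inE permJ !ipi.
Qed.

(* If [sg] and [tau] disagree at [s], some [s'] where they also disagree has
   [i s' = i s] and [i (tau s') = i (sg s)]; the product of two label-preserving
   transpositions carries [s] to [s'] and [sg s] to [tau s'], so that the
   conjugate of [sg] agrees with [tau] at one more point. *)
Lemma same_type_conj sg tau : pairing_on [set: S] sg ->
  pairing_on [set: S] tau ->
  same_type sg tau ->
  exists pi, (forall s, i (pi s) = i s) /\ tau = (sg ^ pi)%g.
Proof.
have [m] := ubnP #|[set s | sg s != tau s]|; elim: m sg => // m IH sg.
rewrite ltnS => Dm psg ptau st; pose D := [set s | sg s != tau s].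
have [D0|/set0Pn[s sD]] := eqVneq D finset.set0.
  exists 1%g; split=> [s|]; first by rewrite perm1.
  rewrite conjg1; apply/permP => s; apply/eqP; rewrite eq_sym -[_ == _]negbK.
  have : s \notin D by rewrite D0 inE.
  by rewrite inE.
have /pairing_onP[isg ssg] := psg; have /pairing_onP[itau stau] := ptau.
have Dsg x : x \in D -> sg x \in D.
  by rewrite !inE isg; apply: contra => /eqP/(congr1 tau); rewrite itau => ->.
have Dtau x : x \in D -> tau x \in D.
  by rewrite !inE itau; apply: contra => /eqP/(congr1 sg); rewrite isg => ->.
(* Off [D] the two pairings coincide, so equality of types gives equal counts inside [D]; there the
   count for [sg] contains [s], so that for [tau] is positive. *)
have [s' /and3P[s'D /eqP is' /eqP its']] :
    exists s', [&& s' \in D, i s' == i s & i (tau s') == i (sg s)].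
  have cD (f : {perm S}) : #|[set x | (i x == i s) && (i (f x) == i (sg s))]| =
      (#|[set x in D | (i x == i s) && (i (f x) == i (sg s))]| +
       #|[set x in ~: D | (i x == i s) && (i (f x) == i (sg s))]|)%N.
    rewrite -(cardsID D); congr (_ + _)%N; apply: eq_card => x;
      rewrite !inE andbC //.
  have := st (i s) (i (sg s)); rewrite !cD.
  have -> : [set x in ~: D | (i x == i s) && (i (sg x) == i (sg s))] =
            [set x in ~: D | (i x == i s) && (i (tau x) == i (sg s))].
    by apply/setP => x; rewrite !inE negbK; case: eqP => [->|].
  move=> /addIn cDE.
  have : (0 < #|[set x in D | (i x == i s) && (i (tau x) == i (sg s))]|)%N.
    by rewrite -cDE; apply/card_gt0P; exists s; rewrite inE sD !eqxx.
  by move=> /card_gt0P[x]; rewrite inE => Hx; exists x.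
(* [y] replaces [sg s] because [s'] may be [sg s] itself, which the first transposition already
   moves. *)
pose y := tperm s s' (sg s); pose z := tau s'.
have iy : i y = i (sg s).
  by rewrite /y; case: tpermP => [sgs|sgs|//]; rewrite sgs.
have ys' : y != s'.
  rewrite /y -{2}(tpermL s s') (inj_eq perm_inj).
  by rewrite ssg inE.
have zs' : z != s' by rewrite /z stau inE.
have yD : y \in D by rewrite /y; case: tpermP => // *; exact: Dsg.
have zD : z \in D by exact: Dtau.
pose pi : {perm S} := (tperm s s' * tperm y z)%g.
have ipi x : i (pi x) = i x.
  rewrite permM; have iw w : i (tperm y z w) = i w.
    by case: tpermP => [->|->|//]; rewrite iy /z its'.
  by rewrite iw; case: tpermP => [->|->|].
have piD x : x \notin D -> pi x = x.
  move=> xD; have nx w : w \in D -> w != x by apply: contraTneq => ->.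
  by rewrite permM !tpermD ?nx.
have pis : pi s = s' by rewrite permM tpermL tpermD.
have pisg : pi (sg s) = tau s' by rewrite permM -/y tpermL.
have [||||pi' [ipi' tauE]] := IH (sg ^ pi)%g.
(* Points outside [D] are fixed by [pi], so no new disagreement appears, and the one at [s']
   disappears. *)
- apply: leq_trans Dm; apply: proper_card; apply/properP; split.
    apply/fintype.subsetP => x; rewrite inE; apply: contraR => xD;
      rewrite -{1}(piD _ xD) permJ.
    have : sg x == tau x by rewrite -[_ == _]negbK; move: xD; rewrite inE.
    move=> /eqP e; rewrite piD ?e //; apply: contra xD => txD.
    by rewrite -[x]itau -e; have := Dtau _ txD; rewrite e.
  by exists s' => //; rewrite inE -{1}pis permJ pisg eqxx.
- exact: pairing_onJ.
- exact: ptau.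
- exact: same_typeJ.
exists (pi * pi')%g; split=> [x|]; first by rewrite permM ipi' ipi.
by rewrite conjgM.
Qed.

End Transitivity.

(** Fibers over the same label have equal size, so their enumerations are matched position by
    position; empty types are treated apart because [nth] needs a default point. *)
Lemma label_preserving_bijection (A B L : finType) (f : A -> L) (g : B -> L) :
  (forall k, #|[set x | f x == k]%SET| = #|[set y | g y == k]%SET|) ->
  exists2 h : A -> B, bijective h & forall x, g (h x) = f x.
Proof.
move=> fg.
have cAB : #|A| = #|B|.
  rewrite -!sum1_card (partition_big f predT) //
    [RHS](partition_big g predT) //.
  by apply: eq_bigr => k _; rewrite !sum1dep_card fg.
have [x0|A0] := pickP A; last first.
  have nA (x : A) : False by have := A0 x.
  exists (fun x : A => False_rect B (nA x)) => [|x]; last by case: (nA x).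
  by apply: inj_card_bij; rewrite ?cAB // => x; case: (nA x).
have [y0 _|B0] := pickP B; last by move: cAB; rewrite (eq_card0 B0) (cardD1 x0).
pose F k := enum [set x | f x == k]%SET;
  pose G k := enum [set y | g y == k]%SET.
have FG k : size (F k) = size (G k) by rewrite -!cardE.
have xF x : x \in F (f x) by rewrite mem_enum inE.
pose h x := nth y0 (G (f x)) (index x (F (f x))).
have hG x : h x \in G (f x) by rewrite mem_nth // -FG index_mem.
have gh x : g (h x) = f x by have := hG x; rewrite mem_enum inE => /eqP.
exists h => //; apply: inj_card_bij; last by rewrite cAB.
move=> x x' hx; have fx : f x = f x' by rewrite -!gh hx.
move: hx; rewrite /h fx => /eqP; rewrite nth_uniq ?enum_uniq //; last 2 first.
- by rewrite -FG index_mem -fx.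
- by rewrite -FG index_mem.
by move=> /eqP/(congr1 (nth x0 (F (f x')))); rewrite !nth_index // -fx.
Qed.

(** * Pairings glued from pairings of the fibers of a map *)

Section Gluing.
Local Close Scope classical_set_scope.
Local Open Scope set_scope.
Variable S : finType.
Implicit Types (A : {set S}) (sg tau : {perm S}).

(* The identity when [f] is not involutive. *)
Definition involution_perm (f : S -> S) : {perm S} :=
  odflt 1%g [pick sg : {perm S} | [forall s, sg s == f s]].

Lemma involution_permE (f : S -> S) : involutive f -> involution_perm f =1 f.
Proof.
move=> invf; rewrite /involution_perm; case: pickP => [sg /forallP H s|H].
  exact/eqP/H.
have /forallP[] := negbT (H (perm (inv_inj invf))).
by move=> s; rewrite permE.
Qed.

Section Fibers.
Variables (q : nat) (c : S -> 'I_q).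

Definition fiber (k : 'I_q) : {set S} := [set s | c s == k].

Variable Q : 'I_q -> {perm S} -> bool.
Hypothesis localQ :
  forall k sg tau, {in fiber k, sg =1 tau} -> Q k sg = Q k tau.

(** A pairing preserving [c] amounts to one pairing of each fiber: [F] cuts it, with the identity
    off the fiber, and [g] glues the pieces back. By locality, [Q k] is not affected by the
    cutting. *)
Lemma card_pairings_fiberwise :
  #|[set sg | [&& pairing_on [set: S] sg, [forall s, c (sg s) == c s]
              & [forall k, Q k sg]]]|
  = (\prod_k #|[set tau | pairing_on (fiber k) tau && Q k tau]|)%N.
Proof.
pose cut sg k s := if c s == k then sg s else s.
pose F sg := [ffun k => involution_perm (cut sg k)].
set D := [set sg | _].
have cutE sg k : sg \in D -> involution_perm (cut sg k) =1 cut sg k.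
  rewrite inE => /and3P[/pairing_onP[inv _] /forallP csg _].
  apply: involution_permE => s; rewrite /cut.
  have [cs|cs] := eqVneq (c s) k; last by rewrite (negPf cs).
  by rewrite (eqP (csg s)) cs eqxx inv.
have injF : {in D &, injective F}.
  move=> sg tau sgD tauD /ffunP FE; apply/permP => s; have := FE (c s).
  rewrite !ffunE => /permP/(_ s); rewrite !cutE // /cut eqxx //.
rewrite -(card_in_imset injF) -[RHS]/(\prod_k #|_|)%N.
rewrite -(_ : #|[set f | f \in family (fun k =>
  mem [set tau | pairing_on (fiber k) tau && Q k tau])]|
    = \prod_k #|[set tau | pairing_on (fiber k) tau && Q k tau]|)%N; last first.
  by rewrite cardsE card_family foldrE big_map big_enum.
apply: eq_card => f; rewrite inE; apply/imsetP/familyP => [[sg sgD ->] k|famf].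
  rewrite !inE ffunE; have := sgD;
    rewrite inE => /and3P[/pairing_onP[inv supp] /forallP csg /forallP Qsg].
  apply/andP; split.
    apply/pairing_onP; split=> s; rewrite ?cutE // /cut.
      have [cs|cs] := eqVneq (c s) k; last by rewrite (negPf cs).
      by rewrite (eqP (csg s)) cs eqxx inv.
    by rewrite inE; case: ifP => _; rewrite ?eqxx // supp inE.
  rewrite -(@localQ k sg) //; move=> s; rewrite inE => cs.
  by rewrite cutE // /cut cs.
have fP k : pairing_on (fiber k) (f k) && Q k (f k) by have := famf k;
  rewrite !inE.
have cf s k : c s = k -> c (f k s) = k.
  move=> cs; have /andP[pk _] := fP k.
  have := pairing_on_neq pk (t := s); rewrite !inE cs eqxx => /(_ isT).
  by case/andP => _ /eqP.
pose g s := f (c s) s.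
have invg : involutive g.
  move=> s; rewrite /g (cf s (c s)) //.
  by have /andP[/pairing_onP[inv _] _] := fP (c s); rewrite inv.
have gE := involution_permE invg.
have gD : involution_perm g \in D.
  rewrite inE; apply/and3P; split.
  - apply/pairing_onP; split=> s; rewrite !gE ?invg // /g inE.
    by have /andP[/pairing_onP[_ ->] _] := fP (c s); rewrite inE eqxx.
  - by apply/forallP => s; rewrite gE /g (cf s (c s)).
  - apply/forallP => k; have /andP[_] := fP k;
    rewrite (@localQ k _ (involution_perm g)) //.
    by move=> s; rewrite inE => /eqP cs; rewrite gE /g cs.
exists (involution_perm g) => //; apply/ffunP => k; rewrite ffunE;
  apply/permP => s.
rewrite cutE // /cut gE /g; case: eqP => [->//|cs].
have /andP[/pairing_onP[_ supp] _] := fP k.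
by apply/eqP; rewrite -[_ == _]negbK supp inE; apply/eqP.
Qed.

End Fibers.

Definition pairing_type (p : nat) (i : S -> 'I_p) A sg : 'M[nat]_p :=
  (\matrix_(k, l) #|[set s in A | (i s == k) && (i (sg s) == l)]|)%R.

Lemma eq_pairing_type p (i : S -> 'I_p) A sg tau :
  {in A, sg =1 tau} -> pairing_type i A sg = pairing_type i A tau.
Proof.
move=> eqA; apply/matrixP => k l; rewrite !mxE; apply: eq_card => s.
by rewrite !inE; case: (boolP (s \in A)) => // sA; rewrite eqA.
Qed.

Lemma pairing_type_fibers p (i : S -> 'I_p) q (c : S -> 'I_q) sg :
  pairing_type i [set: S] sg = (\sum_k pairing_type i (fiber c k) sg)%R.
Proof.
apply/matrixP => k l; rewrite summxE mxE -sum1_card.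
rewrite (partition_big c predT) //=; apply: eq_bigr => x _;
  rewrite mxE -sum1_card.
by apply: eq_bigl => s; rewrite !inE andbC.
Qed.

(** Symmetry comes from exchanging each point with its partner, and the row sums from sorting points
    by the label of their partner. Diagonal entries are even because the points counted there are
    paired among themselves; [tau] is that smaller pairing. *)
Lemma pairing_type_pair_types p (i : S -> 'I_p) A sg (v : 'cV[nat]_p) :
  pairing_on A sg -> (forall k, v k ord0 = #|[set s in A | i s == k]|) ->
  pair_types v (pairing_type i A sg).
Proof.
move=> psg vE; have /pairing_onP[inv supp] := psg.
have sgA s : (sg s \in A) = (s \in A) by rewrite -!supp inv eq_sym.
split.
- apply/matrixP => k l; rewrite !mxE -(card_imset _ (@perm_inj _ sg)).
  apply: eq_card => s; rewrite -[s]inv mem_imset; last exact: perm_inj.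
  by rewrite !inE !inv sgA; congr (_ && _); exact: andbC.
- move=> k; rewrite mxE; set B := [set s in A | _].
  pose tau := involution_perm (fun s => if s \in B then sg s else s).
  have sgB s : (sg s \in B) = (s \in B).
    by rewrite !inE sgA inv [(i (sg s) == k) && _]andbC.
  have tauE : tau =1 (fun s => if s \in B then sg s else s).
    by apply: involution_permE => s; case: (boolP (s \in B)) => sB;
      rewrite ?sgB ?sB ?(negPf sB).
  have ptau : pairing_on B tau.
    apply/pairing_onP; split=> s; rewrite !tauE; case: (boolP (s \in B)) => sB.
    + by rewrite sgB sB.
    + by rewrite (negPf sB).
    + by rewrite supp; move: sB; rewrite inE => /andP[].
    + by rewrite eqxx.
  exact: card_pairing_on_even ptau.
- move=> k; rewrite vE; under eq_bigr do rewrite mxE.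
  rewrite -sum1_card (partition_big (fun s => i (sg s)) predT) //=.
  by apply: eq_bigr => l _; rewrite -sum1_card; apply: eq_bigl => s;
    rewrite !inE andbA.
Qed.

End Gluing.

(** * Consecutive blocks, and pairings as set partitions *)

Section Blocks.
Local Close Scope classical_set_scope.
Local Open Scope set_scope.
Variables (p : nat) (v : 'cV[nat]_p).

Let psum (k : nat) : nat := (\sum_(i < p | (i < k)%N) v i ord0)%N.

Let psum_mono k l : (k <= l)%N -> (psum k <= psum l)%N.
Proof.
move=> kl; rewrite /psum [leqRHS](bigID (fun i : 'I_p => (i < k)%N)) /=.
apply: leq_trans (leq_addr _ _); rewrite leq_eqVlt; apply/orP; left; apply/eqP.
by apply: eq_bigl => i; apply/idP/andP => [ik|[]//]; split=> //;
  exact: leq_trans kl.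
Qed.

Let psum_total : psum p = (\sum_i v i ord0)%N.
Proof. by apply: eq_bigl => i; rewrite ltn_ord. Qed.

Let mem_block (x : 'I_(\sum_i v i ord0)) k :
  (x \in block v k) = (psum k <= x < psum k.+1)%N.
Proof. by rewrite inE. Qed.

Lemma block_cover (x : 'I_(\sum_i v i ord0)) : exists k, x \in block v k.
Proof.
have xp : exists k, (x < psum k)%N.
  by exists p; rewrite psum_total.
(* Since [psum 0] is 0, the least bound exceeding [x] has a successor index, whose predecessor is
   the block of [x]. *)
case: (ex_minnP xp) => -[|k] xk mink; first by rewrite /psum big_pred0_eq in xk.
have kp : (k < p)%N.
  by apply: mink; rewrite psum_total.
exists (Ordinal kp); rewrite mem_block xk andbT leqNgt; apply/negP => /mink.
by rewrite ltnn.
Qed.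

Definition block_index (x : 'I_(\sum_i v i ord0)) : 'I_p :=
  xchoose (block_cover x).

Lemma block_indexE x k : (x \in block v k) = (block_index x == k).
Proof.
have xb := xchooseP (block_cover x); apply/idP/eqP => [xk|<-//].
rewrite -/(block_index x) in xb; move: xb xk; rewrite !mem_block.
move=> /andP[b1 b2] /andP[k1 k2]; apply/val_inj/eqP; rewrite eqn_leq /=.
apply/andP; split; rewrite leqNgt; apply/negP => lt.
  by have := leq_trans k2 (psum_mono lt); rewrite ltnNge b1.
by have := leq_trans b2 (psum_mono lt); rewrite ltnNge k1.
Qed.

Lemma card_block k : #|block v k| = v k ord0.
Proof.
rewrite -sum1_card (eq_bigl (fun x : 'I_(\sum_i v i ord0) =>
  psum k <= x < psum k.+1)%N);
  last by move=> x; rewrite mem_block.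
have le_psum : (psum k.+1 <= \sum_i v i ord0)%N.
  rewrite /psum big_mkcond; apply: leq_sum => i _; by case: ifP.
rewrite -(big_mkord (fun x => psum k <= x < psum k.+1)%N (fun=> 1%N)).
have -> : (\sum_(0 <= x < \sum_i v i ord0 | psum k <= x < psum k.+1) 1 =
           \sum_(psum k <= x < psum k.+1) 1)%N.
  rewrite [RHS](big_nat_widen _ _ _ _ _ le_psum) [RHS](big_nat_widenl _ 0) //=.
  by apply: eq_bigl => x; rewrite andbC.
rewrite sum_nat_const_nat muln1 /psum (bigD1 k) //= addnC.
have -> : (\sum_(i < p | (i < k.+1) && (i != k)) v i ord0 =
           \sum_(i < p | i < k) v i ord0)%N.
  by apply: eq_bigl => i; rewrite ltnS ltn_neqAle andbC.
by rewrite addKn.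
Qed.

Variables (S : finType) (A : {set S}) (h : 'I_(\sum_i v i ord0) -> S).
Hypotheses (injh : injective h) (hA : h @: [set: 'I_(\sum_i v i ord0)] = A).
Implicit Types (sg : {perm S}) (P : {set {set 'I_(\sum_i v i ord0)}}).

Let hP s : reflect (exists x, s = h x) (s \in A).
Proof.
by rewrite -hA; apply: (iffP imsetP) => [[x _ ->]|[x ->]]; exists x;
  rewrite ?inE.
Qed.

(** The set partition into pairs given by the involution [sg], pulled back along [h]; it links
    involutions of [A] to the encoding used by [Kcoef]. *)
Let blocks_of sg : {set {set 'I_(\sum_i v i ord0)}} :=
  [set [set xy.1; xy.2] | xy in
    [set xy : 'I_(\sum_i v i ord0) * 'I_(\sum_i v i ord0) |
      h xy.2 == sg (h xy.1)]].

Let blocks_ofP sg B :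
  reflect (exists x y, h y = sg (h x) /\ B = [set x; y]) (B \in blocks_of sg).
Proof.
apply: (iffP imsetP) => [[[x y]]|[x [y [hy ->]]]].
  by rewrite inE /= => /eqP hy ->; exists x, y.
by exists (x, y); rewrite // inE /= hy.
Qed.

Let mate sg x : pairing_on A sg -> exists2 y, h y = sg (h x) & y != x.
Proof.
move=> psg; have hx : h x \in A by apply/hP; exists x.
have := pairing_on_neq psg hx; rewrite !inE => /andP[ne /hP[y hy]].
by exists y; rewrite // -(inj_eq injh) -hy.
Qed.

Let mem_blocks_of sg B x : pairing_on A sg -> B \in blocks_of sg -> x \in B ->
  exists y, h y = sg (h x) /\ B = [set x; y].
Proof.
move=> /pairing_onP[inv _] /blocks_ofP[a [b [hb ->]]]; rewrite !inE.
move=> /orP[/eqP->|/eqP->]; first by exists b.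
by exists a; rewrite hb inv finset.setUC.
Qed.

Let set2_mem_blocks_of sg x y : pairing_on A sg ->
  ([set x; y] \in blocks_of sg) = (h y == sg (h x)).
Proof.
move=> psg; apply/idP/eqP => [xy|hy]; last by apply/blocks_ofP; exists x, y.
have [|z [hz xyE]] := mem_blocks_of (x := x) psg xy; first by rewrite !inE eqxx.
have [z' hz' nz'] := mate x psg; have zz' : z = z' by apply: injh;
  rewrite hz hz'.
have : z \in [set x; y] by rewrite xyE !inE eqxx orbT.
by rewrite !inE zz' (negPf nz') /= => /eqP <-.
Qed.

Let is_pairing_blocks_of sg : pairing_on A sg -> is_pairing (blocks_of sg).
Proof.
move=> psg; apply/andP; split; last first.
  apply/forallP => B; apply/implyP => /blocks_ofP[x [y [hy ->]]].
  have [y' hy' ny'] := mate x psg.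
  have -> : y = y' by apply: injh; rewrite hy hy'.
  by rewrite cards2 (eq_sym x) ny'.
apply/and3P; split.
- rewrite finset.eqEsubset finset.subsetT; apply/fintype.subsetP => x _;
  have [y hy _] := mate x psg.
  apply/finset.bigcupP; exists [set x; y]; last by rewrite !inE eqxx.
  by apply/blocks_ofP; exists x, y.
- apply/finset.trivIsetP => B C BG CG;
  apply: contraR => /pred0Pn[x /andP[/= xB xC]].
  have [y [hy ->]] := mem_blocks_of psg BG xB.
  have [z [hz ->]] := mem_blocks_of psg CG xC.
  by apply/eqP; congr [set _; _]; apply: injh; rewrite hy hz.
- apply/negP => /blocks_ofP[x [y [_ /setP/(_ x)]]].
  by rewrite !inE eqxx.
Qed.

Let is_pairingP P : is_pairing P -> forall x,
  exists2 y, y != x /\ [set x; y] \in P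
    & forall z, z != x -> [set x; z] \in P -> z = y.
Proof.
move=> /andP[partP /forallP card2] x.
have /and3P[/eqP covP trivP _] := partP.
have xcov : x \in finset.cover P by rewrite covP inE.
have BP := finset.pblock_mem xcov;
  have xB : x \in finset.pblock P x by rewrite finset.mem_pblock.
have /implyP/(_ BP)/cards2P[a [b [ab BE]]] := card2 (finset.pblock P x).
have [y ny yB] : exists2 y, y != x & finset.pblock P x = [set x; y].
  move: xB; rewrite BE !inE => /orP[/eqP->|/eqP->].
    by exists b; rewrite // eq_sym.
  by exists a; rewrite // finset.setUC.
exists y; first by rewrite -yB.
move=> z nz zP; have xz : x \in [set x; z] by rewrite !inE eqxx.
have := finset.def_pblock trivP zP xz; rewrite yB => /setP/(_ z).
by rewrite !inE eqxx orbT (negPf nz) /= => /eqP.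
Qed.

Let blocks_of_surj P : is_pairing P ->
  exists2 sg, pairing_on A sg & blocks_of sg = P.
Proof.
move=> pP; have mateP := is_pairingP pP.
(* [f] sends a point of [A] to its partner in [P]. The outer default is the identity off [A]; the
   inner one is never reached, as every point has a partner. *)
pose f s := if [pick x | h x == s] is Some x then
  if [pick y | (y != x) && ([set x; y] \in P)] is Some y then h y else s else s.
have fh x y : y != x -> [set x; y] \in P -> f (h x) = h y.
  move=> ny yP; rewrite /f; case: pickP => [x' /eqP/injh->|/(_ x)];
    last by rewrite eqxx.
  case: pickP => [z /andP[nz zP]|/(_ y)]; last by rewrite ny yP.
  by have [w _ uw] := mateP x; rewrite (uw _ ny yP) (uw _ nz zP).
have fA s : s \notin A -> f s = s.
  move=> sA; rewrite /f; case: pickP => // x /eqP hx.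
  by case/negP: sA; apply/hP; exists x.
have invf : involutive f.
  move=> s; have [/hP[x ->]|sA] := boolP (s \in A); last by rewrite !fA.
  have [y [ny yP] _] := mateP x; rewrite (fh _ _ ny yP).
  by rewrite (fh y x) // 1?eq_sym // finset.setUC.
have fE := involution_permE invf.
have psg : pairing_on A (involution_perm f).
  apply/pairing_onP; split=> s; rewrite !fE ?invf //.
  have [/hP[x ->]|sA] := boolP (s \in A); last by rewrite fA ?eqxx.
  by have [y [ny yP] _] := mateP x; rewrite (fh _ _ ny yP) (inj_eq injh).
exists (involution_perm f) => //; apply/setP => B; apply/idP/idP.
  move=> /blocks_ofP[x [y [hy ->]]]; have [z [nz zP] _] := mateP x.
  by move: hy; rewrite fE (fh _ _ nz zP) => /injh->.
move=> BP; have /andP[_ /forallP/(_ B)/implyP/(_ BP)] := pP.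
move=> /cards2P[x [y [xy BE]]]; rewrite BE set2_mem_blocks_of // fE.
by rewrite (fh x y) // 1?eq_sym // -BE.
Qed.

(** [blocks_of] is a bijection from pairings of [A] onto set partitions into pairs, and labels
    corresponding under [h] give equal types. Hence K_r(v) can be counted by involutions on any
    labelled copy of the points. *)
Lemma Kcoef_card_pairing (i : S -> 'I_p) (r : 'M[nat]_p) :
  (forall x, i (h x) = block_index x) ->
  Kcoef v r = #|[set sg | pairing_on A sg && (pairing_type i A sg == r)]|.
Proof.
move=> ih; rewrite /Kcoef.
have typeE sg : pairing_on A sg ->
    has_type r (blocks_of sg) = (pairing_type i A sg == r).
  move=> psg; have cE k l : #|[set x in block v k |
      [exists y in block v l, [set x;
        y] \in blocks_of sg]]| = pairing_type i A sg k l.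
    rewrite mxE -(card_imset _ injh); apply: eq_card => s.
    apply/imsetP/idP => [[x /finset.setIdP[xk /existsP[y /andP[yl hy]]] ->]|].
      move: xk yl hy; rewrite !block_indexE set2_mem_blocks_of // =>
        /eqP xk /eqP yl /eqP hy.
      rewrite inE; apply/and3P; split; [by apply/hP;
        exists x|by rewrite ih xk|].
      by rewrite -hy ih yl.
    rewrite inE => /and3P[/hP[x ->]]; rewrite ih => xk sl; exists x => //.
    rewrite inE block_indexE xk /=; have [y hy ny] := mate x psg.
    apply/exists_inP; exists y; last by rewrite set2_mem_blocks_of // hy.
    by rewrite block_indexE -ih hy.
  apply/forallP/eqP => [tr|<- k]; last first.
    by apply/forallP => l; rewrite -cE.
  apply/matrixP => k l; rewrite -cE; exact/eqP/(forallP (tr k)).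
rewrite -(card_in_imset (f := blocks_of)).
  apply: eq_card => P; rewrite inE; apply/andP/imsetP => [[pP tP]|[sg]].
    have [sg psg sgP] := blocks_of_surj pP; exists sg => //.
    by rewrite inE psg -typeE // sgP.
  rewrite inE => /andP[psg tsg] ->; rewrite is_pairing_blocks_of //.
  by rewrite typeE.
move=> sg tau; rewrite !inE => /andP[psg _] /andP[ptau _] sgtau.
apply/permP => s; have [/hP[x ->]|sA] := boolP (s \in A).
  have [y hy _] := mate x psg.
  have : [set x; y] \in blocks_of sg by rewrite set2_mem_blocks_of // hy.
  by rewrite sgtau set2_mem_blocks_of // hy => /eqP.
have fixA (f : {perm S}) : pairing_on A f -> f s = s.
  by move=> /pairing_onP[_ supp]; apply/eqP; rewrite -[_ == _]negbK supp.
by rewrite !fixA.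
Qed.

End Blocks.

(** * Moments of the Haar measure *)

Lemma continuous_mx_coord {K : realType} m n (X : topologicalType)
    (f : X -> 'M[K]_(m, n)) :
  (forall i j, continuous (fun x => f x i j)) -> continuous f.
Proof.
move=> cf x A [P Pf PA].
have : \forall y \near x, forall i j, P i j (f y i j).
  by apply: filter_forall => i; apply: filter_forall => j; exact: cf.
by apply: filterS => y Py; exact: PA.
Qed.

(** * The Haar integral as an invariant functional *)

Section HaarFunctional.
Context {R : realType} {n : nat} (mu : probability (borel_mx R n) R).
Hypothesis mu_haar : is_haar mu.
Implicit Types (f g : 'M[R]_n -> R) (h : 'M[R]_n).
Local Notation On := (@orthogonal_mx R n).

Lemma continuous_borel_mx f : continuous f ->
  measurable_fun [set: borel_mx R n] (f : borel_mx R n -> R).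
Proof.
move=> /continuousP cf; apply: (measurability _ (RGenOpens.measurableE R)).
move=> _ [_ [a [b ->]] <-]; rewrite setTI; apply: sub_sigma_algebra.
exact/cf/interval_open.
Qed.

Lemma continuous_mx_entry (i j : 'I_n) : continuous (fun u : 'M[R]_n => u i j).
Proof. exact: coord_continuous. Qed.

Lemma continuous_sumr (I : Type) (s : seq I) (F : I -> 'M[R]_n -> R) :
  (forall i, continuous (F i)) -> continuous (fun u => \sum_(i <- s) F i u).
Proof.
move=> cF; elim: s => [|i s IH] u.
  by under eq_fun do rewrite big_nil; exact: cst_continuous.
under eq_fun do rewrite big_cons.
by apply: (@continuousD _ R _ (F i)); [exact: cF|exact: IH].
Qed.

Lemma continuous_mulmx h : continuous (mulmx h : 'M[R]_n -> 'M[R]_n).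
Proof.
apply: continuous_mx_coord => i j; under eq_fun do rewrite mxE.
apply: continuous_sumr => k u.
by apply: continuousM; [exact: cst_continuous|exact: continuous_mx_entry].
Qed.

Lemma measurable_mulmx h :
  measurable_fun [set: borel_mx R n] (mulmx h : borel_mx R n -> borel_mx R n).
Proof.
apply: (@measurability _ _ (borel_mx R n) (borel_mx R n) setT (mulmx h)
  (@open 'M[R]_n)); first by [].
move=> _ [A oA <-]; rewrite setTI; apply: sub_sigma_algebra.
by have /continuousP := @continuous_mulmx h; apply.
Qed.

Lemma orthogonal_mxC u : On u -> u^T *m u = 1%:M.
Proof. exact: mulmx1C. Qed.

Lemma orthogonal_trmx u : On u -> On u^T.
Proof. by move=> /orthogonal_mxC; rewrite /orthogonal_mx /= trmxK. Qed.

Lemma orthogonal_mul u v : On u -> On v -> On (u *m v).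
Proof.
rewrite /orthogonal_mx /= => uO vO.
by rewrite trmx_mul mulmxA -(mulmxA u) vO mulmx1.
Qed.

(** Orthogonality is a finite system of equations, each cutting out the preimage of a point under a
    continuous function. *)
Lemma measurable_orthogonal : measurable (On : set (borel_mx R n)).
Proof.
have -> : On = \bigcap_(i in [set: 'I_n]) \bigcap_(j in [set: 'I_n])
    [set u : borel_mx R n | (u *m u^T) i j = (1%:M : 'M[R]_n) i j].
  apply/seteqP; split=> u /=;
    first by rewrite /orthogonal_mx /= => uO i _ j _ /=; rewrite uO.
  by move=> uO; apply/matrixP => i j; exact: uO.
apply: fin_bigcap_measurable => // i _; apply: fin_bigcap_measurable => // j _.
have -> : [set u : borel_mx R n | (u *m u^T) i j = (1%:M : 'M[R]_n) i j] =
    [set: borel_mx R n] `&` (fun u : 'M[R]_n =>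
      (u *m u^T) i j) @^-1` [set (1%:M : 'M[R]_n) i j].
  by rewrite setTI.
apply: (continuous_borel_mx _ measurableT (measurable_set1 _)).
under eq_fun do rewrite mxE.
apply: continuous_sumr => k u; apply: continuousM;
  first exact: continuous_mx_entry.
have -> : (fun v : 'M[R]_n => v^T k j) = (fun v => v j k).
  by apply/funext => v; rewrite mxE.
exact: continuous_mx_entry.
Qed.

Lemma orthogonal_entry_le1 u i j : On u -> `|u i j| <= 1.
Proof.
move=> /matrixP/(_ i i); rewrite !mxE eqxx (bigD1 j) //= !mxE => uO.
rewrite -(@expr_le1 _ 2) // real_normK ?num_real // expr2.
suff : 0 <= \sum_(k < n | k != j) u i k * u^T k i by move: uO; lra.
by apply: sumr_ge0 => k _; rewrite !mxE -expr2 sqr_ge0.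
Qed.

Lemma haar_orthogonal : mu On = 1%E.
Proof. by case: mu_haar. Qed.

(** A class of integrands closed under sums and products; the bound is asked on the group only,
    since the entries are bounded there and not on all matrices. *)
Definition bounded_borel f :=
  measurable_fun [set: borel_mx R n] (f : borel_mx R n -> R) /\
  exists M, forall u, On u -> `|f u| <= M.

Lemma bounded_borel_integrable f : bounded_borel f ->
  mu.-integrable On (EFin \o f).
Proof.
move=> [mf [M fM]]; apply: measurable_bounded_integrable.
- exact: measurable_orthogonal.
- by rewrite [X in (X < _)%E]haar_orthogonal ltry.
- exact: measurable_funTS.
- exists M; split; first by rewrite num_real.
  by move=> x Mx u uO; apply: le_trans (fM _ uO) (ltW Mx).
Qed.

Lemma bounded_borelM f g :
  bounded_borel f -> bounded_borel g -> bounded_borel (fun u => f u * g u).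
Proof.
move=> [mf [M fM]] [mg [N gN]]; split; first exact: measurable_funM.
by exists (M * N) => u uO; rewrite normrM ler_pM // ?fM ?gN.
Qed.

Lemma bounded_borelD f g :
  bounded_borel f -> bounded_borel g -> bounded_borel (fun u => f u + g u).
Proof.
move=> [mf [M fM]] [mg [N gN]]; split; first exact: measurable_funD.
by exists (M + N) => u uO; rewrite (le_trans (ler_normD _ _)) // lerD ?fM ?gN.
Qed.

Lemma bounded_borel_cst c : bounded_borel (fun=> c).
Proof. by split; [exact: measurable_cst|exists `|c|]. Qed.

Lemma bounded_borel_entry i j : bounded_borel (fun u => u i j).
Proof.
split; first by apply: continuous_borel_mx; exact: continuous_mx_entry.
by exists 1 => u uO; exact: orthogonal_entry_le1.
Qed.

Lemma bounded_borel_prod (I : Type) (s : seq I) (P : pred I) F :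
  (forall i, P i -> bounded_borel (F i)) ->
  bounded_borel (fun u => \prod_(i <- s | P i) F i u).
Proof.
move=> bF; elim: s => [|i s IH].
  under eq_fun do rewrite big_nil; exact: bounded_borel_cst.
case Pi: (P i); under eq_fun do rewrite big_cons Pi; last by [].
by apply: bounded_borelM => //; exact: bF.
Qed.

Definition haarE f := \int[mu]_(u in On) f u.

Lemma eq_haarE f g : (forall u, On u -> f u = g u) -> haarE f = haarE g.
Proof. by move=> fg; apply: eq_Rintegral => u /set_mem/fg. Qed.

Lemma haarE_cst c : haarE (fun=> c) = c.
Proof.
rewrite /haarE Rintegral_cst; last exact: measurable_orthogonal.
by rewrite [X in fine X]haar_orthogonal /= mulr1.
Qed.

Lemma haarED f g : bounded_borel f -> bounded_borel g ->
  haarE (fun u => f u + g u) = haarE f + haarE g.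
Proof.
by move=> bf bg; apply: RintegralD => //;
  [exact: measurable_orthogonal|exact: bounded_borel_integrable..].
Qed.

Lemma haarEZ c f : bounded_borel f ->
  haarE (fun u => c * f u) = c * haarE f.
Proof.
by move=> bf; apply: RintegralZl => //;
  [exact: measurable_orthogonal|exact: bounded_borel_integrable..].
Qed.

Lemma bounded_borel_sum (I : Type) (s : seq I) (P : pred I) F :
  (forall i, P i -> bounded_borel (F i)) ->
  bounded_borel (fun u => \sum_(i <- s | P i) F i u).
Proof.
move=> bF; elim: s => [|i s IH].
  under eq_fun do rewrite big_nil; exact: bounded_borel_cst.
case Pi: (P i); under eq_fun do rewrite big_cons Pi; last by [].
by apply: bounded_borelD => //; exact: bF.
Qed.

Lemma haarE_sum (I : Type) (s : seq I) (P : pred I) F :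
  (forall i, P i -> bounded_borel (F i)) ->
  haarE (fun u => \sum_(i <- s | P i) F i u) = \sum_(i <- s | P i) haarE (F i).
Proof.
move=> bF; elim: s => [|i s IH].
  by rewrite big_nil -[RHS]haarE_cst; apply: eq_haarE => u _; rewrite big_nil.
rewrite big_cons; under [in LHS]eq_fun do rewrite big_cons.
case: ifPn => [Pi|//]; rewrite haarED ?IH //;
  [exact: bF|exact: bounded_borel_sum].
Qed.

Lemma haarE_mulmx h f : On h -> bounded_borel f ->
  haarE (fun u => f (h *m u)) = haarE f.
Proof.
move=> hO [mf [M fM]].
have hO' := orthogonal_trmx hO.
have preO : mulmx h @^-1` On = On.
  apply/seteqP; split=> u /= uO; last exact: orthogonal_mul.
  by rewrite -[u]mul1mx -(orthogonal_mxC hO) -mulmxA; exact: orthogonal_mul.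
have bf : bounded_borel (fun u => f (h *m u)).
  split; first by apply: (measurableT_comp mf); exact: measurable_mulmx.
  by exists M => u uO; apply/fM/orthogonal_mul.
rewrite /haarE /Rintegral; congr fine; apply/esym.
pose hmul : borel_mx R n -> borel_mx R n := mulmx h.
(* The preimage of [A] under multiplication by [h] is its image under the inverse [h^T], to which
   the invariance of [mu] applies. *)
have muE A : measurable A -> pushforward mu hmul A = mu A.
  move=> mA; rewrite /pushforward; case: mu_haar => _ /(_ _ _ hO' mA) <-.
  congr (mu _); apply/seteqP; split=> u /=.
    by exists (h *m u) => //; rewrite mulmxA (orthogonal_mxC hO) mul1mx.
  by move=> [v Av <-]; rewrite /hmul mulmxA hO mul1mx.
transitivity (\int[pushforward mu hmul]_(u in On) (f u)%:E)%E.
  symmetry; apply: eq_measure_integral; first exact: measurable_mulmx.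
  by move=> mh A mA _; exact: muE.
rewrite integral_pushforward //=.
- by rewrite preO.
- exact: measurable_mulmx.
- exact/measurable_EFinP.
- by rewrite preO; exact: (bounded_borel_integrable bf).
- exact: measurable_orthogonal.
Qed.

(** * Moments of the entries and integration by parts *)

Section Moments.
Variable S : finType.
Implicit Types (A : {set S}) (i j : S -> 'I_n).
Local Close Scope classical_set_scope.
Local Open Scope set_scope.

Definition mon A i j (u : 'M[R]_n) : R := \prod_(s in A) u (i s) (j s).
Definition mom A i j : R := haarE (mon A i j).

Lemma bounded_borel_mon A i j : bounded_borel (mon A i j).
Proof. by apply: bounded_borel_prod => s _; exact: bounded_borel_entry. Qed.

(** The choice [t = s] moves a single point. *)
Definition set_rows i (t s : S) (k : 'I_n) : S -> 'I_n :=
  fun x => if (x == t) || (x == s) then k else i x.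

Lemma mon_set_rows A i j t s k u : t \in A -> s \in A -> t != s ->
  mon A (set_rows i t s k) j u =
  u k (j t) * u k (j s) * mon (A :\ t :\ s) i j u.
Proof.
move=> tA sA ts; rewrite /mon (big_setD1 t) //= (big_setD1 s) /=; last first.
  by rewrite !inE eq_sym ts.
rewrite /set_rows !eqxx orbT mulrA; congr (_ * _); apply: eq_bigr => x.
by rewrite !inE => /and3P[/negPf-> /negPf-> _].
Qed.

(** The columns [j t] and [j s] of an orthogonal matrix are orthonormal, and the letters of [t] and
    [s] run together through all rows. *)
Lemma mom_orthogonality A i j t s : t \in A -> s \in A -> t != s ->
  \sum_k mom A (set_rows i t s k) j =
  (j t == j s)%:R * mom (A :\ t :\ s) i j.
Proof.
move=> tA sA ts; rewrite -haarE_sum; last by move=> k _;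
  exact: bounded_borel_mon.
rewrite -haarEZ; last exact: bounded_borel_mon.
apply: eq_haarE => u /orthogonal_mxC/matrixP/(_ (j t) (j s)).
rewrite !mxE => <-; rewrite big_distrl /=; apply: eq_bigr => k _.
by rewrite mon_set_rows // mxE.
Qed.

(** Changing the sign of row [k] is an orthogonal transformation, and it changes the sign of the
    monomial. *)
Lemma mom_odd A i j k : odd #|[set s in A | i s == k]| -> mom A i j = 0.
Proof.
move=> oddk.
pose h : 'M[R]_n := diag_mx (\row_x (-1) ^+ (x == k)).
have hO : On h.
  rewrite /orthogonal_mx /= tr_diag_mx mulmx_diag -diag_const_mx; congr diag_mx.
  by apply/rowP => x; rewrite !mxE -expr2 sqrr_sign.
have: haarE (fun u => mon A i j (h *m u)) = - mom A i j.
  rewrite -mulN1r -haarEZ; last exact: bounded_borel_mon.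
  apply: eq_haarE => u _; rewrite /mon.
  under eq_bigr do rewrite mul_diag_mx !mxE.
  rewrite big_split /=; congr (_ * _).
  rewrite (bigID (fun s => i s == k)) /= [X in _ * X]big1 ?mulr1; last first.
    by move=> s /andP[_ /negPf->].
  rewrite (eq_bigr (fun=> -1)); last by move=> s /andP[_ ->].
  rewrite prodr_const -signr_odd (_ : #|_| =
    #|[set s in A | i s == k]|) ?oddk //.
  by apply: eq_card => s; rewrite !inE.
rewrite haarE_mulmx //; last exact: bounded_borel_mon.
by rewrite -/(mom A i j) => /eqP;
  rewrite -subr_eq0 opprK -mulr2n mulrn_eq0 /= => /eqP.
Qed.

(** For [p != k], the rotation in the plane of the coordinates [p] and [k] with cosine [c] and sine
    [d]. *)
Definition rot_mx (p k : 'I_n) (c d : R) : 'M[R]_n :=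
  1%:M + (c - 1) *: (delta_mx p p + delta_mx k k)
    + d *: (delta_mx p k - delta_mx k p).

Lemma rot_mx_orthogonal p k c d : p != k -> c ^+ 2 + d ^+ 2 = 1 ->
  On (rot_mx p k c d).
Proof.
move=> pk cd; rewrite /orthogonal_mx /= /rot_mx.
set P := delta_mx p p + delta_mx k k.
set J := delta_mx p k - delta_mx k p.
have trP : P^T = P by rewrite linearD /= !trmx_delta.
have trJ : J^T = - J by rewrite linearB /= !trmx_delta opprB.
have kp : (k == p) = false by rewrite eq_sym (negPf pk).
have PP : P *m P = P.
  by rewrite mulmxDl !mulmxDr !mul_delta_mx_cond !eqxx kp (negPf pk) addr0
    add0r.
have PJ : P *m J = J.
  by rewrite mulmxDl !mulmxBr !mul_delta_mx_cond !eqxx kp (negPf pk) subr0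
    sub0r.
have JP : J *m P = J.
  rewrite mulmxBl !mulmxDr !mul_delta_mx_cond !eqxx kp (negPf pk).
  by rewrite add0r addr0.
have JJ : J *m J = - P.
  rewrite mulmxBl !mulmxBr !mul_delta_mx_cond !eqxx kp (negPf pk).
  by rewrite subr0 sub0r opprD.
have -> : (1%:M + (c - 1) *: P + d *: J)^T = 1%:M + (c - 1) *: P - d *: J.
  by rewrite linearD /= linearD /= trmx1 linearZ /= linearZ /= trP trJ scalerN.
rewrite !mulmxDl !mulmxDr !mul1mx !mulmx1 -!scalemxAl -!scalemxAr !mulmxN.
rewrite -!scalemxAr PP PJ JP JJ !scalerN opprK !scalerA.
have -> : (c - 1) * (c - 1) = - 2 * (c - 1) - d * d by move: cd;
  rewrite !expr2; lra.
apply/matrixP => x y; rewrite !mxE; ring.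
Qed.

Lemma rot_mxE p k c d (u : 'M[R]_n) x y : p != k ->
  (rot_mx p k c d *m u) x y =
  if x == p then c * u p y + d * u k y
  else if x == k then c * u k y - d * u p y else u x y.
Proof.
move=> pk; have deltaE a b : (delta_mx a b *m u) x y = (x == a)%:R * u b y.
  rewrite mxE (bigD1 b) //= mxE eqxx andbT big1 ?addr0 // => z /negPf zb.
  by rewrite mxE zb andbF mul0r.
rewrite /rot_mx !mulmxDl mul1mx -!scalemxAl mulmxBl mulmxDl.
rewrite !mxE -!/((delta_mx _ _ *m u) x y).
have dE a b : \sum_z (delta_mx a b : 'M[R]_n) x z * u z y = (x == a)%:R * u b y.
  by rewrite -deltaE mxE.
rewrite !dE; case: (eqVneq x p) => [->|xp].
  by rewrite (negPf pk) /= mulr1n mulr0n; ring.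
by case: (eqVneq x k) => [->|xk] /=; rewrite ?mulr1n ?mulr0n; ring.
Qed.

(** The integers below [size q] are already more roots than a nonzero polynomial of that size can
    have. *)
Lemma poly_eq0_horner (q : {poly R}) : (forall x, q.[x] = 0) -> q = 0.
Proof.
move=> q0; pose rs : seq R := [seq k%:R | k <- iota 0 (size q)].
apply: (@roots_geq_poly_eq0 _ q rs).
- by apply/allP => x _; rewrite /root q0.
- by rewrite map_inj_uniq ?iota_uniq // => a b /eqP; rewrite eqr_nat => /eqP.
- by rewrite size_map size_iota.
Qed.

(* The moment of [i] with the row of [t] replaced by the unused row [k] is
   zero; rotate rows [p] and [k] by an angle of tangent [x] in it and take the
   coefficient of [x]. *)
Lemma mom_integration_by_parts A i j t p k :
    t \in A -> i t = p -> p != k -> {in A, forall s, i s != k} ->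
  mom A i j =
  \sum_(s in A :\ t | i s == p) mom A (set_rows i t s k) j.
Proof.
move=> tA itp pk ik.
pose i' := set_rows i t t k.
(* With [x] the tangent of the angle, rotation turns the letter of [s] into [al s + x * be s], up to
   a cosine that is factored out as [w s]. *)
pose al s (u : 'M[R]_n) := if s \in A then u (i' s) (j s) else 1.
pose be s (u : 'M[R]_n) := if s \in A then
  if s == t then - u p (j t) else if i s == p then u k (j s) else 0 else 0.
have bal s : bounded_borel (al s).
  by rewrite /al; case: (s \in A);
    [exact: bounded_borel_entry|exact: bounded_borel_cst].
have bbe s : bounded_borel (be s).
  rewrite /be; case: (s \in A); last exact: bounded_borel_cst.
  case: (s == t).
    have -> : (fun u : 'M[R]_n => - u p (j t)) = (fun u => -1 * u p (j t)).
      by apply/funext => u; rewrite mulN1r.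
    by apply: bounded_borelM;
      [exact: bounded_borel_cst|exact: bounded_borel_entry].
  by case: (i s == p); [exact: bounded_borel_entry|exact: bounded_borel_cst].
pose term (B : {set S}) u := \prod_s if s \in B then be s u else al s u.
have bterm B : bounded_borel (term B).
  by apply: bounded_borel_prod => s _; case: (s \in B).
(* Expanding the product of the rotated letters over the set [B] where [be] is chosen gives a
   polynomial in the tangent. It vanishes at every real [x], since each is a tangent, with cosine
   [(Num.sqrt (1 + x ^+ 2))^-1]. *)
pose q : {poly R} := \sum_(B : {set S}) haarE (term B) *: 'X^(#|B|).
have q0 : q = 0.
  apply: poly_eq0_horner => x.
  have nx : 0 < 1 + x ^+ 2 by rewrite ltr_pwDl // sqr_ge0.
  pose c : R := (Num.sqrt (1 + x ^+ 2))^-1.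
  have c0 : c != 0 by rewrite invr_eq0 lt0r_neq0 // sqrtr_gt0.
  have cd : c ^+ 2 + (x * c) ^+ 2 = 1.
    rewrite exprMn -[X in X + _]mul1r -mulrDl exprVn sqr_sqrtr ?ltW //.
    by rewrite divff // lt0r_neq0.
  have hO := rot_mx_orthogonal pk cd.
  have bm := bounded_borel_mon A i' j.
  have := haarE_mulmx hO bm.
  rewrite [RHS](_ : _ = 0); last first.
    apply: (@mom_odd _ _ _ k);
      rewrite (_ : [set _ in _ | _] = [set t]) ?cards1 //.
    apply/setP => s; rewrite !inE /i' /set_rows orbb.
    by case: (eqVneq s t) => [->|st]; rewrite ?tA ?eqxx //;
      case: (boolP (s \in A)) => // /ik/negPf.
  pose w s : R := if s \in A then if (s == t) || (i s == p) then c else 1 else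
    1.
  have w0 : \prod_s w s != 0.
    apply/prodf_neq0 => s _; rewrite /w; case: ifP => _; last exact: oner_neq0.
    by case: ifP => _ //; exact: oner_neq0.
  have monE u : mon A i' j (rot_mx p k c (x * c) *m u) =
      (\prod_s w s) * \prod_s (x * be s u + al s u).
    rewrite /mon big_mkcond -big_split /=; apply: eq_bigr => s _.
    rewrite /w /al /be rot_mxE // /i' /set_rows orbb; case: ifPn => sA;
      last by ring.
    case: (eqVneq s t) => [->|st] /=; first by rewrite eq_sym (negPf pk) eqxx;
      ring.
    rewrite (negPf (ik _ sA)); case: eqP => [->|_]; ring.
  rewrite (@eq_haarE _ (fun u =>
    (\prod_s w s) * \prod_s (x * be s u + al s u))) //.
  rewrite haarEZ; last first.
    apply: bounded_borel_prod => s _; apply: bounded_borelD => //.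
    by apply: bounded_borelM => //; exact: bounded_borel_cst.
  move=> /eqP; rewrite mulf_eq0 (negPf w0) /= => /eqP E0.
  rewrite -[RHS]E0 /q horner_sum.
  transitivity (haarE (fun u => \sum_(B : {set S}) x ^+ #|B| * term B u)).
    rewrite haarE_sum; last first.
      by move=> B _; apply: bounded_borelM => //; exact: bounded_borel_cst.
    by apply: eq_bigr => B _; rewrite hornerZ hornerXn haarEZ // mulrC.
  apply: eq_haarE => u _; rewrite bigA_distr; apply: eq_bigr => B _.
  rewrite -prodr_const [X in X * _]big_mkcond -big_split /=.
  by apply: eq_bigr => s _; case: ifP => // _; rewrite mul1r.
(* Only singletons contribute to the coefficient of [x]: [t] gives minus the original moment,
   another point of row [p] gives the moment with both points in row [k], and the rest give 0. *)
have := congr1 (fun q : {poly R} => q`_1) q0.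
rewrite coef0 /q coef_sum => /eqP.
rewrite (eq_bigr (fun B : {set S} =>
  if #|B| == 1%N then haarE (term B) : R else 0)); last first.
  by move=> B _; rewrite coefZ coefXn eq_sym; case: eqP; rewrite ?mulr1 ?mulr0.
rewrite -big_mkcond big_cards1 (bigD1 t) //=.
have termt : haarE (term [set t]) = - mom A i j.
  rewrite -mulN1r -haarEZ; last exact: bounded_borel_mon.
  apply: eq_haarE => u _;
    rewrite /term /mon (bigD1 t) //= inE eqxx [in RHS](bigD1 t) //=.
  rewrite mulrA /be tA eqxx itp mulN1r; congr (_ * _).
  rewrite [in RHS]big_mkcond [in LHS]big_mkcond; apply: eq_bigr => s _;
    rewrite inE.
  rewrite /al /i' /set_rows orbb; case: (eqVneq s t) => [->|st] /=;
    first by rewrite andbF.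
  by rewrite andbT; case: ifP.
rewrite termt addrC subr_eq0 => /eqP <-.
rewrite [RHS]big_mkcond [LHS]big_mkcond; apply: eq_bigr => s _; rewrite !inE.
case: (eqVneq s t) => //= st; case: (boolP (s \in A)) => sA /=; last first.
  rewrite -[RHS]haarE_cst; apply: eq_haarE => u _; apply/eqP.
  by rewrite /term (bigD1 s) //= inE eqxx /be (negPf sA) mul0r.
case: (boolP (i s == p)) => isp; last first.
  rewrite -[RHS]haarE_cst; apply: eq_haarE => u _; apply/eqP.
  by rewrite /term (bigD1 s) //= inE eqxx /be sA (negPf st) (negPf isp) mul0r.
apply: eq_haarE => u _; rewrite /term /mon [RHS]big_mkcond;
  apply: eq_bigr => y _.
rewrite inE /be /al /i' /set_rows orbb.
case: (eqVneq y s) => [->|ys]; first by rewrite sA (negPf st) isp orbT.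
by rewrite orbF.
Qed.

(* Summing the integration by parts over the rows [k > p] and completing to
   all [k] by orthogonality leaves only smaller rows. *)
Lemma mom_recursion A i j t p :
    t \in A -> i t = p -> {in A, forall s, (i s <= p)%N} ->
  (n - p.+1 + #|[set s in A :\ t | i s == p]|)%:R * mom A i j =
  \sum_(s in A :\ t | i s == p)
     ((j t == j s)%:R * mom (A :\ t :\ s) i j
      - \sum_(k < n | (k < p)%N) mom A (set_rows i t s k) j).
Proof.
move=> tA itp maxp.
have -> : \sum_(s in A :\ t | i s == p)
     ((j t == j s)%:R * mom (A :\ t :\ s) i j
      - \sum_(k < n | (k < p)%N) mom A (set_rows i t s k) j) =
  \sum_(s in A :\ t | i s == p) (mom A i j
      + \sum_(k < n | (p < k)%N) mom A (set_rows i t s k) j).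
  (* Orthogonality writes the first term as a sum over all rows [k]: the rows below [p] cancel, and
     row [p], where [t] and [s] already lie, gives the original moment. *)
  apply: eq_bigr => s /andP[]; rewrite !inE => /andP[st sA] /eqP isp.
  rewrite -mom_orthogonality 1?eq_sym //.
  rewrite (bigID (fun k : 'I_n => (k < p)%N)) /= addrAC subrr add0r.
  rewrite (bigD1 p) ?ltnn //=; congr (_ + _).
    apply: eq_haarE => u _; apply: eq_bigr => x _; rewrite /set_rows.
    by case: eqP => [->|_]; [rewrite itp|case: eqP => [->|]; rewrite ?isp].
  by apply: eq_bigl => k; rewrite -leqNgt ltn_neqAle andbC (eq_sym k).
rewrite big_split /= exchange_big /= sumr_const.
rewrite (eq_bigr (fun=> mom A i j)); last first.
  move=> k pk; rewrite [RHS](@mom_integration_by_parts _ _ _ t p k) //.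
    by rewrite neq_ltn pk.
  by move=> s /maxp sp; rewrite neq_ltn (leq_ltn_trans sp pk).
rewrite sumr_const -[RHS]mulrnDr -[RHS]mulr_natl addnC; congr (_ %:R * _).
congr (_ + _)%N.
  by apply: eq_card => s; rewrite [RHS]unfold_in inE.
rewrite -sum1_card big_mkcond /= -(big_mkord xpredT (fun k =>
  if (p < k)%N then 1 else 0)%N).
rewrite (big_cat_nat (n := p.+1)) //= [X in (X + _)%N]big1_seq ?add0n;
  last first.
  move=> k /andP[_]; rewrite mem_index_iota => /andP[_]; rewrite ltnS.
  by rewrite ltnNge => ->.
rewrite big_seq (eq_bigr (fun=> 1%N)) -?big_seq ?sum_nat_const_nat ?muln1 //.
by move=> k; rewrite mem_index_iota => /andP[->].
Qed.

End Moments.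

(** * Expansion of moments over pairings *)

Section PairingExpansion.
Variable S : finType.
Implicit Types (A : {set S}) (sg tau pi : {perm S}) (phi psi : (S -> 'I_n) ->
  R).
Local Close Scope classical_set_scope.
Local Open Scope set_scope.

Definition compatible (T : eqType) (j : S -> T) sg :=
  [forall s, j (sg s) == j s].

(** The coefficients must not depend on [j]; this uniformity is what allows matrices with the same
    rows to be compared. *)
Definition in_pairing_span A (f : (S -> 'I_n) -> R) :=
  exists c : {perm S} -> R, forall j,
    f j = \sum_(sg | pairing_on A sg) c sg * (compatible j sg)%:R.

Lemma in_pairing_spanZ A a phi :
  in_pairing_span A phi -> in_pairing_span A (fun j => a * phi j).
Proof.
move=> [c fc]; exists (fun sg => a * c sg) => j; rewrite fc mulr_sumr.
by apply: eq_bigr => sg _; rewrite mulrA.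
Qed.

Lemma in_pairing_spanD A phi psi : in_pairing_span A phi ->
  in_pairing_span A psi ->
  in_pairing_span A (fun j => phi j + psi j).
Proof.
move=> [c1 f1c] [c2 f2c]; exists (fun sg => c1 sg + c2 sg) => j.
by rewrite f1c f2c -big_split; apply: eq_bigr => sg _; rewrite mulrDl.
Qed.

Lemma in_pairing_span0 A : in_pairing_span A (fun=> 0).
Proof. by exists (fun=> 0) => j; rewrite big1 // => sg _; rewrite mul0r. Qed.

Lemma in_pairing_span_sum A (I : finType) (P : pred I) (f : I -> (S ->
  'I_n) -> R) :
  (forall x, P x -> in_pairing_span A (f x)) ->
  in_pairing_span A (fun j => \sum_(x | P x) f x j).
Proof.
move=> fA; have H x : exists c : {perm S} -> R, P x -> forall j,
    f x j = \sum_(sg | pairing_on A sg) c sg * (compatible j sg)%:R.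
  by case: (boolP (P x)) => [/fA[c cE]|_]; [exists c|exists (fun=> 0)].
have [c cE] := boolp.choice H.
exists (fun sg => \sum_(x | P x) c x sg) => j.
under [RHS]eq_bigr do rewrite mulr_suml.
by rewrite exchange_big; apply: eq_bigr => x Px; exact: cE.
Qed.

Lemma compatible_tpermM A (j : S -> 'I_n) t s tau :
  pairing_on (A :\ t :\ s) tau ->
  compatible j (tau * tperm t s)%g = (j t == j s) && compatible j tau.
Proof.
move=> /pairing_onP[inv supp].
have taut : tau t = t by apply/eqP; rewrite -[_ == _]negbK supp !inE eqxx andbF.
have taus : tau s = s by apply/eqP; rewrite -[_ == _]negbK supp !inE eqxx.
apply/forallP/andP => [H|[/eqP ts /forallP H] x]; last first.
  rewrite permM; case: tpermP => [e|e|_ _]; last exact: H.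
    by rewrite -ts -e; exact: H.
  by rewrite ts -e; exact: H.
have jts : j t = j s by have := H t; rewrite permM taut tpermL => /eqP.
split; first by rewrite jts.
apply/forallP => x; have := H x; rewrite permM.
by case: tpermP => [->|->|//]; rewrite jts.
Qed.

Lemma in_pairing_span_delta A t s phi : t != s -> t \in A -> s \in A ->
  in_pairing_span (A :\ t :\ s) phi ->
  in_pairing_span A (fun j => (j t == j s)%:R * phi j).
Proof.
move=> ts tA sA [c fc].
(* The coefficient of a pairing joining [t] to [s] is that of the pairing left after removing this
   pair; the other pairings get 0. *)
exists (fun sg => if sg t == s then c (sg * tperm t s)%g else 0) => j.
rewrite (bigID (fun sg : {perm S} => sg t == s)) /= [X in _ + X]big1 ?addr0;
  last first.
  by move=> sg /andP[_ /negPf->]; rewrite mul0r.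
rewrite (big_pairing_on_fiber _ ts tA sA) fc mulr_sumr.
apply: eq_bigr => tau ptau; rewrite (compatible_tpermM _ ptau).
have := ptau; rewrite -(pairing_on_tpermM _ ts tA sA) => /andP[_ ->].
by rewrite -mulgA tperm2 mulg1 -mulnb natrM mulrCA.
Qed.

(* Induction along [mom_recursion] for a letter [t] in the largest row. *)
Lemma mom_in_pairing_span A (i : S -> 'I_n) : in_pairing_span A (mom A i).
Proof.
(* This measure drops both when two points are removed and when two points move to a smaller row;
   the successor makes points of row 0 count. *)
have [m] := ubnP (\sum_(s in A) (i s).+1)%N; elim: m A i => // m IH A i.
rewrite ltnS => Am.
have [->|/set0Pn[t0 t0A]] := eqVneq A finset.set0.
  exists (fun=> 1) => j; rewrite (big_pred1 1%g) => [|sg];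
    last exact: pairing_on0.
  rewrite mul1r (_ : compatible j (1%g : {perm S}));
    last by apply/forallP => s; rewrite perm1.
  rewrite -[RHS](haarE_cst 1); apply: eq_haarE => u _.
  by rewrite /mon big_set0.
case: (arg_maxnP (fun t => i t : nat) t0A) => t tA' maxt;
  have tA : t \in A := tA'.
pose B := [set s in A :\ t | i s == i t].
(* If [t] is alone in its row the moment vanishes by parity. Otherwise [B] is nonempty, which keeps
   the factor [N] nonzero even when the row of [t] is the last one. *)
have [B0|Bn0] := eqVneq #|B| 0%N.
  suff -> : mom A i = fun=> 0 by exact: in_pairing_span0.
  apply/funext => j; apply: (@mom_odd _ A i j (i t)).
  rewrite (_ : [set _ in _ | _] = [set t]) ?cards1 //; apply/setP => s.
  rewrite !inE; have [->|st] := eqVneq s t; first by rewrite tA eqxx.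
  have : s \notin B by rewrite (cards0_eq B0) inE.
  by rewrite !inE st => /negPf.
have rec := mom_recursion _ tA erefl (fun s sA => maxt s sA).
pose N : R := (n - (i t).+1 + #|B|)%:R.
have N0 : N != 0 by rewrite pnatr_eq0 addn_eq0 negb_and Bn0 orbT.
have -> : mom A i = fun j => N^-1 * \sum_(s in A :\ t | i s == i t)
     ((j t == j s)%:R * mom (A :\ t :\ s) i j
      + \sum_(k < n | (k < i t)%N) (-1) * mom A (set_rows i t s k) j).
  apply/funext => j; apply: (mulfI N0); rewrite mulVKf // rec.
  apply: eq_bigr => s _; congr (_ + _); rewrite -sumrN.
  by apply: eq_bigr => k _; rewrite mulN1r.
apply: in_pairing_spanZ; apply: in_pairing_span_sum => s /andP[].
rewrite !inE => /andP[st sA] /eqP ist.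
have ts : t != s by rewrite eq_sym.
have sAt : s \in A :\ t by rewrite !inE st.
have AE (f : S -> nat) : (\sum_(x in A) f x =
  f t + (f s + \sum_(x in A :\ t :\ s) f x))%N.
  by rewrite (big_setD1 t) //= (big_setD1 s).
apply: in_pairing_spanD.
  apply: in_pairing_span_delta => //; apply: IH; apply: leq_trans Am.
  by rewrite AE; lia.
apply: in_pairing_span_sum => k kt; apply: in_pairing_spanZ; apply: IH.
apply: leq_trans Am; rewrite !AE.
have -> : (\sum_(x in A :\ t :\ s) (set_rows i t s k x).+1 =
           \sum_(x in A :\ t :\ s) (i x).+1)%N.
  apply: eq_bigr => x; rewrite !inE /set_rows => /and3P[/negPf-> /negPf-> _].
  by [].
rewrite /set_rows !eqxx orbT ist !addnA ltn_add2r; move: kt.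
by move: (nat_of_ord k) (nat_of_ord (i t)) => x y; lia.
Qed.

Lemma compatibleJ (T : eqType) (j : S -> T) sg pi :
  compatible (j \o pi) sg = compatible j (sg ^ pi)%g.
Proof.
apply/forallP/forallP => H s; last by rewrite /= -permJ; exact: H.
by rewrite -[s](permKV pi) permJ; exact: H.
Qed.

Lemma mom_perm (i j : S -> 'I_n) (pi : {perm S}) : i \o pi =1 i ->
  mom [set: S] i (j \o pi) = mom [set: S] i j.
Proof.
move=> ipi; apply: eq_haarE => u _;
  rewrite /mon [RHS](reindex_inj (@perm_inj _ pi)).
by apply: eq_big => [s|s _]; rewrite ?inE //= -[in LHS]ipi.
Qed.

(* Averaging the coefficients over the row-preserving relabelings of the
   points makes them depend only on the type of the pairing. *)
Lemma mom_pairing_types p (le_pn : (p <= n)%N) (i : S -> 'I_p) :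
  exists g : 'M[nat]_p -> R, forall j : S -> 'I_n,
    mom [set: S] (widen_ord le_pn \o i) j =
    \sum_(sg | pairing_on [set: S] sg && compatible j sg)
      g (pairing_type i [set: S] sg).
Proof.
set i' := widen_ord le_pn \o i.
have [c cE] := mom_in_pairing_span [set: S] i'.
pose Stab := [set pi : {perm S} | [forall s, i (pi s) == i s]].
have StabP (pi : {perm S}) : reflect (forall s, i (pi s) = i s) (pi \in Stab).
  by rewrite inE; apply: (iffP forallP) => H s; [exact/eqP|exact/eqP/H].
have Stab1 : 1%g \in Stab by apply/StabP => s; rewrite perm1.
have N0 : #|Stab|%:R != 0 :> R by rewrite pnatr_eq0 -lt0n; apply/card_gt0P;
  exists 1%g.
(* Averaging over the group [Stab] makes the coefficients invariant under conjugation by its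
   elements. *)
pose c' sg := #|Stab|%:R^-1 * \sum_(pi in Stab) c (sg ^ pi^-1)%g.
have c'J sg rho : rho \in Stab -> c' (sg ^ rho)%g = c' sg.
  move=> rhoS; have rhoE := elimT (StabP rho) rhoS.
  congr (_ * _); rewrite (reindex_inj (mulIg rho)) /=.
  apply: eq_big => [pi|pi _]; last by rewrite -conjgM invMg mulKVg.
  apply/StabP/StabP => H s; last by rewrite permM rhoE H.
  by have := H s; rewrite permM rhoE.
(* Pairings of equal type are conjugate under [Stab], so the pairing picked does not matter; the
   default 0 concerns matrices that are the type of no pairing. *)
pose g (r : 'M[nat]_p) : R := if [pick sg | pairing_on [set: S] sg &&
  (pairing_type i [set: S] sg == r)] is Some sg then c' sg else 0.
have c'g sg : pairing_on [set: S] sg -> c' sg = g (pairing_type i [set: S] sg).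
  move=> psg; rewrite /g; case: pickP => [tau /andP[ptau /eqP tE]|/(_ sg)];
    last first.
    by rewrite psg eqxx.
  have [|pi [ipi ->]] := @same_type_conj S _ i tau sg ptau psg.
    move=> k l; have := congr1 (fun M : 'M[nat]_p => M k l) tE.
    rewrite !mxE => e; apply: etrans (etrans e _); apply: eq_card => s;
      by rewrite !inE.
  by rewrite c'J //; apply/StabP.
exists g => j.
have -> : mom [set: S] i' j =
  #|Stab|%:R^-1 * \sum_(pi in Stab) mom [set: S] i' (j \o pi).
  rewrite (eq_bigr (fun=> mom [set: S] i' j)) => [|pi /StabP piS]; last first.
    by apply: mom_perm => s; rewrite /= /i' /= piS.
  by rewrite sumr_const -[X in _ * X]mulr_natl mulKf.
rewrite big_mkcondr /=.
rewrite [RHS](eq_bigr (fun sg => c' sg * (compatible j sg)%:R)); last first.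
  by move=> sg psg; rewrite -c'g //; case: ifP; rewrite ?mulr1 ?mulr0.
rewrite /c'; under [RHS]eq_bigr do rewrite -mulrA mulr_suml.
rewrite -mulr_sumr exchange_big /=; congr (_ * _); apply: eq_bigr => pi piS.
(* Conjugating pairings by [pi] amounts to composing [j] with [pi], which leaves the moment
   unchanged; the average thus passes from the moments to the coefficients. *)
rewrite cE [RHS](reindex_inj (conjg_inj pi)) /=.
apply: eq_big => [sg|sg _]; last by rewrite compatibleJ -conjgM mulgV conjg1.
apply/idP/idP => [|psg]; first exact: pairing_onJ.
by have := pairing_onJ pi^-1%g psg; rewrite -conjgM mulgV conjg1.
Qed.

End PairingExpansion.

(** * Matrix integrals as moments *)

Section MatrixIntegrals.
Local Close Scope classical_set_scope.
Local Open Scope set_scope.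

(** Equal letters of the monomial are grouped by row and column; the bounds on [p] and [q] keep
    [entry] away from its default. *)
Lemma Iint_mom (S : finType) p q (le_pn : (p <= n)%N) (le_qn : (q <= n)%N)
    (a : 'M[nat]_(p, q)) (i : S -> 'I_p) (j : S -> 'I_q) :
  (forall k l, a k l = #|[set s | (i s == k) && (j s == l)]|) ->
  Iint mu a = mom [set: S] (widen_ord le_pn \o i) (widen_ord le_qn \o j).
Proof.
move=> aE; apply: eq_haarE => u _; rewrite /mon.
rewrite (partition_big (fun s => (i s, j s)) predT) //= pair_big /=.
apply: eq_bigr => -[k l] _ /=.
rewrite (eq_bigr (fun=> u (widen_ord le_pn k) (widen_ord le_qn l))); last first.
  by move=> s /andP[_ /eqP[-> ->]].
rewrite prodr_const aE /entry; congr (_ ^+ _); last first.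
  by apply: eq_card => s; rewrite !inE [RHS]unfold_in /= inE.
rewrite (insubT (fun x => x < n)%N (leq_trans (ltn_ord k) le_pn)).
rewrite (insubT (fun x => x < n)%N (leq_trans (ltn_ord l) le_qn)).
by congr (u _ _); apply: val_inj.
Qed.

(** [g] is chosen before [q], [a] and [j], so one function of the type serves every matrix whose
    rows are read off from [i]. *)
Lemma Iint_pairing_types (S : finType) p (le_pn : (p <= n)%N) (i : S -> 'I_p) :
  exists g : 'M[nat]_p -> R, forall q (a : 'M[nat]_(p, q)) (j : S -> 'I_q),
    (q <= n)%N -> (forall k l, a k l = #|[set s | (i s == k) && (j s == l)]|) ->
    Iint mu a = \sum_(sg | pairing_on [set: S] sg && compatible j sg)
      g (pairing_type i [set: S] sg).
Proof.
have [g gE] := mom_pairing_types le_pn i; exists g => q a j le_qn aE.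
rewrite (Iint_mom le_pn le_qn aE) gE; exact: eq_bigl.
Qed.

End MatrixIntegrals.

End HaarFunctional.

(** * The columns of E'_r *)

Section ColumnExpansion.
Local Close Scope classical_set_scope.
Local Open Scope set_scope.

Lemma restrict_pairing (S : finType) (T : eqType) (c : S ->
  T) k (sg : {perm S}) :
  pairing_on [set: S] sg -> compatible c sg ->
  exists2 tau, pairing_on [set s | c s == k] tau
    & {in [set s | c s == k], sg =1 tau}.
Proof.
move=> /pairing_onP[inv supp] /forallP csg.
have invf : involutive (fun s => if c s == k then sg s else s).
  move=> s /=; have [cs|cs] := eqVneq (c s) k; last by rewrite (negPf cs).
  by rewrite (eqP (csg s)) cs eqxx inv.
exists (involution_perm (fun s => if c s == k then sg s else s)).
  apply/pairing_onP; split=> s; rewrite ?involution_permE //.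
  by rewrite inE; case: ifP => _; rewrite ?eqxx // supp inE.
by move=> s; rewrite inE involution_permE // => ->.
Qed.

Lemma fiber_pair_types (S : finType) p q (i : S -> 'I_p) (c : S -> 'I_q)
    (a : 'M[nat]_(p, q)) sg k :
  (forall x y, a x y = #|[set s | (i s == x) && (c s == y)]|) ->
  pairing_on [set: S] sg -> compatible c sg ->
  pair_types (col k a) (pairing_type i (fiber c k) sg).
Proof.
move=> aE psg csg; have [tau ptau sgtau] := restrict_pairing k psg csg.
rewrite (eq_pairing_type i sgtau); apply: pairing_type_pair_types => // x.
by rewrite mxE aE; apply: eq_card => s; rewrite !inE andbC.
Qed.

(** The cells of [b], with multiplicity, form a set matched with [S] row by row, and the columns are
    carried over. This places E'_r(a) on the same points as [a]. *)
Lemma mx_word (S : finType) p q (i : S -> 'I_p) (b : 'M[nat]_(p, q)) :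
  (forall x, #|[set s | i s == x]| = (\sum_y b x y)%N) ->
  exists j : S -> 'I_q,
    forall x y, b x y = #|[set s | (i s == x) && (j s == y)]|.
Proof.
move=> ib; pose T_ (xy : 'I_p * 'I_q) := 'I_(b xy.1 xy.2);
  pose S2 := {xy & T_ xy}.
have cS2 x y : #|[set z : S2 | tag z == (x, y)]| = b x y.
  have injT : injective (fun w : 'I_(b x y) => @Tagged _ (x, y) T_ w).
    by move=> w w' /eqP; rewrite eq_Tagged => /eqP.
  rewrite -[RHS]card_ord -(card_imset _ injT); apply: eq_card => z.
  rewrite inE; apply/eqP/imsetP => [|[w _ ->] //].
  by case: z => xy w /= e; subst xy; exists w.
have [|h bijh ih] := @label_preserving_bijection S S2 'I_p i (fun z =>
  (tag z).1).
  move=> x; rewrite ib -sum1_card (partition_big (fun z : S2 =>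
    (tag z).2) predT) //=.
  apply: eq_bigr => y _; rewrite -cS2 -sum1_card; apply: eq_bigl => z.
  by rewrite !inE.
exists (fun s => (tag (h s)).2) => x y;
  rewrite -cS2 -(card_imset _ (bij_inj bijh)).
have [h' hK h'K] := bijh; apply: eq_card => z; rewrite inE.
rewrite -[z in RHS]h'K mem_imset; last exact: bij_inj.
by rewrite inE h'K -ih h'K.
Qed.

Lemma sum_over_Ecols p q (r : {ffun 'I_q -> 'M[nat]_p}) (F : 'cV[nat]_p ->
  nat) :
  (\sum_(v <- Ecols r) F v =
   \sum_k F (\col_i (if i == k then total_type r k k else 0)) +
   \sum_(k < p) \sum_(l < p | k < l)
     total_type r k l * F (\col_i (((i == k) || (i == l)) : nat))%R)%N.
Proof.
rewrite /Ecols big_flatten big_allpairs_dep /= big_enum -big_split /=.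
apply: eq_bigr => k _; rewrite big_filter big_enum_cond /=.
rewrite (bigD1 k) //= [in X in (X + _)%N]/Eblock eqxx big_seq1; congr (_ + _)%N.
apply: eq_big => [l|l /andP[_ lk]]; first by rewrite ltn_neqAle eq_sym andbC.
by rewrite /Eblock eq_sym (negPf lk) big_nseq iter_addn_0 mulnC.
Qed.

(** * Row sums and forced pairings of the columns *)

Section PairColumns.
Variables (p q : nat) (r : {ffun 'I_q -> 'M[nat]_p}).
Hypotheses (symR : forall k l, total_type r k l =
  total_type r l k) (evenR : forall k, ~~ odd (total_type r k k)).

(** Row [x] meets its diagonal block, the blocks [(x, l)] with [l > x], and the blocks [(k, x)] with
    [k < x]; symmetry moves the last ones to row [x] of the total type. *)
Lemma sum_Ecols_row x : (\sum_(v <- Ecols r) v x ord0 =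
  \sum_l total_type r x l)%N.
Proof.
rewrite sum_over_Ecols.
have -> : (\sum_k (\col_i (if i == k then total_type r k k else 0))%R x ord0 =
  total_type r x x)%N.
  rewrite (bigD1 x) //= mxE eqxx big1 ?addn0 // => k kx.
  by rewrite mxE eq_sym (negPf kx).
rewrite [RHS](bigD1 x) //=; congr (_ + _)%N.
rewrite [RHS](bigID (fun l : 'I_p => x < l)%N) /=.
rewrite (bigD1 x) //=; congr (_ + _)%N.
  apply: eq_big => [l|l _]; last by rewrite mxE eqxx muln1.
  by rewrite neq_ltn; case: ltngtP => //; rewrite ltnn.
rewrite [RHS]big_mkcond [LHS]big_mkcond /=; apply: eq_bigr => k _.
case: (eqVneq k x) => [->|kx] /=; first by [].
have [xk|kx'] := ltnP x k.
  rewrite big1 // => l kl; rewrite mxE eq_sym (negPf kx) /=.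
  have [xl|_] := eqVneq x l; last by rewrite /= muln0.
  by have := ltn_trans xk kl; rewrite -xl ltnn.
have kltx : (k < x)%N by rewrite ltn_neqAle kx'  andbT.
rewrite (bigD1 x) //= mxE eqxx orbT muln1 big1 => [|l /andP[_ lx]].
  by rewrite addn0 symR.
by rewrite mxE eq_sym (negPf kx) eq_sym (negPf lx) muln0.
Qed.

(** Only the columns of the block of [x] and [y] are nonzero in both rows, and each contributes
    1. *)
Lemma sum_Ecols_rows x y : x != y ->
  (\sum_(v <- Ecols r) v x ord0 * v y ord0 = total_type r x y)%N.
Proof.
wlog xy : x y / (x < y)%N => [H ne|_].
  have := ne; rewrite neq_ltn => /orP[xy|yx]; first exact: H.
  by rewrite symR -H // 1?eq_sym //; apply: eq_bigr => v _; rewrite mulnC.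
rewrite sum_over_Ecols big1 ?add0n => [|k _]; last first.
  rewrite !mxE; have [xk|xk] := eqVneq x k; rewrite ?mul0n //.
  by rewrite -[y == k]/(val y == val k) -xk gtn_eqF ?muln0.
rewrite (bigD1 x) //= (bigD1 y) //= !mxE !eqxx !orbT !muln1.
rewrite big1 ?addn0 => [|l /andP[xl ly]]; last first.
  by rewrite !mxE [y == l]eq_sym (negPf ly) -[y == x]/(val y == val x) gtn_eqF
    // muln0 muln0.
rewrite big1 ?addn0 // => k kx; rewrite big1 // => l kl; rewrite !mxE.
rewrite [x == k]eq_sym (negPf kx) /=.
have [xl|] := eqVneq x l; last by rewrite muln0.
rewrite -[y == l]/(val y == val l) -xl gtn_eqF // orbF.
by rewrite -[y == k]/(val y == val k) gtn_eqF ?muln0 // (ltn_trans _ xy) // xl.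
Qed.

Lemma mem_Ecols v : v \in Ecols r ->
  (exists2 k, ~~ odd (v k ord0) & forall i, i != k -> v i ord0 = 0%N) \/
  (exists k l, k != l /\ v = (\col_i (((i == k) || (i == l)) : nat))%R).
Proof.
move=> /flattenP[s /allpairsPdep[k [l [_ _ ->]]]]; rewrite /Eblock.
case: eqVneq => [_|kl]; last by move=> /nseqP[-> _]; right; exists k, l.
rewrite inE => /eqP ->; left; exists k => [|i ik];
  first by rewrite mxE eqxx evenR.
by rewrite mxE (negPf ik).
Qed.

(** A column with one nonzero entry allows no pair between different rows. In a column with two
    ones, the diagonal of [t] is even and at most 1, hence 0, so the two points are paired
    together. *)
Lemma pair_types_Ecols v t x y : v \in Ecols r -> pair_types v t -> x != y ->
  t x y = (v x ord0 * v y ord0)%N.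
Proof.
move=> vE [symt event rowt] xy.
have st k l : t k l = t l k by rewrite -[in LHS]symt mxE.
have tle k l : (t k l <= v k ord0)%N by rewrite -rowt (bigD1 l) //= leq_addr.
have [[k evk v0]|[k [l [kl vkl]]]] := mem_Ecols vE.
  have [xk|xk] := eqVneq x k.
    have yk : y != k by rewrite -xk eq_sym.
    apply/eqP; rewrite [v y ord0]v0 // muln0 -leqn0 -(v0 y yk) st; exact: tle.
  by apply/eqP; rewrite [v x ord0]v0 // mul0n -leqn0 -(v0 x xk); exact: tle.
have v0 i : i != k -> i != l -> v i ord0 = 0%N.
  by move=> ik il; rewrite vkl mxE (negPf ik) (negPf il).
have vk : v k ord0 = 1%N by rewrite vkl mxE eqxx.
have vl : v l ord0 = 1%N by rewrite vkl mxE eqxx orbT.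
have t0 i j : v i ord0 = 0%N -> t i j = 0%N.
  by move=> vi; apply/eqP; rewrite -leqn0 -vi; exact: tle.
have tkk : t k k = 0%N.
  by have := event k; have := tle k k; rewrite vk; case: (t k k) => [|[]].
have tkl : t k l = 1%N.
  have := rowt k; rewrite (bigD1 l) //= big1 ?addn0 => [->//|i il].
  have [->//|ik] := eqVneq i k; by rewrite st t0 // v0.
have [xk|xk] := eqVneq x k; have [yk|yk] := eqVneq y k.
- by rewrite xk yk eqxx in xy.
- rewrite xk vk mul1n; have [->|yl] := eqVneq y l; first by rewrite tkl vl.
  by rewrite st t0 v0.
- rewrite yk vk muln1; have [->|xl] := eqVneq x l; first by rewrite st tkl vl.
  by rewrite t0 v0.
- have [xl|xl] := eqVneq x l; last by rewrite t0 v0.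
  have yl : y != l by rewrite -xl eq_sym.
  have vy : v y ord0 = 0%N by exact: v0.
  by rewrite st t0 // vy muln0.
Qed.

(** A column of the first kind has a single nonzero entry; one of the second kind has two points,
    and the shifted double factorials of 0, 1 and 2 are all 1. *)
Lemma dfact_Ecols v : v \in Ecols r ->
  ~~ odd (\sum_x v x ord0) /\
  dfact (\sum_x v x ord0) = (\prod_x dfact (v x ord0))%N.
Proof.
have d0 : dfact 0 = 1%N by rewrite /dfact big_geq.
have d1 : dfact 1 = 1%N by rewrite /dfact big_geq.
move=> vE; have [[k evk v0]|[k [l [kl ->]]]] := mem_Ecols vE.
  have -> : (\sum_x v x ord0 = v k ord0)%N by rewrite (bigD1 k) //= big1 ?addn0.
  by rewrite (bigD1 k) //= big1 ?muln1 // => i /v0->.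
pose w i := (((i == k) || (i == l)) : nat).
have -> : (\sum_x (\col_i w i)%R x ord0 = 2)%N.
  rewrite (bigD1 k) //= (bigD1 l) /=; last by rewrite eq_sym.
  rewrite !mxE /w !eqxx orbT big1 // => i /andP[ik il].
  by rewrite mxE (negPf ik) (negPf il).
rewrite big1 ?dfactSS ?d0 // => i _; rewrite mxE /w.
by case: (_ || _).
Qed.

End PairColumns.

Lemma dfact_gt0 m : (0 < dfact m)%N.
Proof.
rewrite /dfact big_seq_cond; apply: prodn_cond_gt0 => k /andP[].
by rewrite mem_index_iota => /andP[].
Qed.

End ColumnExpansion.

(** * The identity *)

Section MainIdentity.
Context {R : realType} {n : nat} (mu : probability (borel_mx R n) R).
Local Close Scope classical_set_scope.
Local Open Scope set_scope.

Definition type_expansion (S : finType) p (i : S -> 'I_p) (g : 'M[nat]_p ->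
  R) :=
  forall q (b : 'M[nat]_(p, q)) (j : S -> 'I_q), (q <= n)%N ->
    (forall k l, b k l = #|[set s | (i s == k) && (j s == l)]|) ->
    Iint mu b = \sum_(sg | pairing_on [set: S] sg && compatible j sg)
      g (pairing_type i [set: S] sg).

(* Every pairing compatible with the columns of [Emx r] has type
   [total_type r]. *)
Lemma Iint_Emx (S : finType) p q (i : S -> 'I_p) g (r : {ffun 'I_q ->
  'M[nat]_p}) :
  type_expansion i g -> (size (Ecols r) <= n)%N ->
  (forall k l, total_type r k l = total_type r l k) ->
  (forall k, ~~ odd (total_type r k k)) ->
  (forall k, #|[set s | i s == k]| = (\sum_l total_type r k l)%N) ->
  Iint mu (Emx r) = (\prod_k \prod_l dfact (Emx r k l))%N%:R * g (total_type r).
Proof.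
move=> gE le_En symr evenr rowr.
pose v y := tnth (in_tuple (Ecols r)) y.
have vE y : v y \in Ecols r by exact: mem_tnth.
have EE x y : Emx r x y = v y x ord0 by rewrite mxE.
have sumE F : (\sum_(u <- Ecols r) F u = \sum_y F (v y))%N by rewrite big_tnth.
have [|j jE] := @mx_word S p _ i (Emx r).
  move=> x; rewrite rowr -(sum_Ecols_row symr) sumE.
  by apply: eq_bigr => y _; rewrite EE.
rewrite (gE _ _ _ le_En jE).
rewrite (eq_bigr (fun=> g (total_type r))) => [|sg /andP[psg csg]]; last first.
  (* Off the diagonal, the type is the sum over the columns of the forced values, which is the total
     type. *)
  congr g; have offdiag x y : x != y ->
      pairing_type i [set: S] sg x y = total_type r x y.
    move=> xy; rewrite (pairing_type_fibers i j) summxE.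
    rewrite -(sum_Ecols_rows symr xy) sumE; apply: eq_bigr => z _.
    apply: (pair_types_Ecols evenr (vE z)) => //.
    have -> : v z = col z (Emx r) by apply/colP => w; rewrite !mxE.
    exact: fiber_pair_types.
  have colE k : (\col_k #|[set s | i s == k]|)%R k ord0 =
      #|[set s in [set: S] | i s == k]|.
    by rewrite mxE; apply: eq_card => s; rewrite !inE.
  have [_ _ rowsg] := pairing_type_pair_types psg colE.
  (* The diagonal entries then follow from the equality of row sums. *)
  apply/matrixP => x y; have [<-|] := eqVneq x y; last exact: offdiag.
  have := rowsg x; rewrite mxE rowr (bigD1 x) //= [RHS](bigD1 x) //=.
  rewrite (eq_bigr (fun l => total_type r x l)) => [|l lx]; last first.
    by rewrite offdiag // eq_sym.
  by move=> /addIn.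
rewrite sumr_const -[LHS]mulr_natl; congr (_%:R * _).
(* It remains to count the compatible pairings: they split into independent pairings of the
   columns. *)
have := @card_pairings_fiberwise S _ j (fun _ _ => true) (fun _ _ _ _ => erefl).
rewrite exchange_big /= => cE; apply: etrans (etrans cE _).
  apply: eq_card => sg; rewrite !inE unfold_in /=; congr (_ && _).
  by rewrite /compatible; case: [forall s, _] => //=; apply/esym/forallP.
apply: eq_bigr => y _.
have [evy dy] := dfact_Ecols evenr (vE y).
have cy : #|fiber j y| = (\sum_x v y x ord0)%N.
  rewrite -sum1_card (partition_big i predT) //=; apply: eq_bigr => x _.
  by rewrite -EE jE -sum1_card; apply: eq_bigl => s; rewrite !inE andbC.
rewrite (eq_bigr (fun x => dfact (v y x ord0))) => [|x _]; last by rewrite EE.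
rewrite -dy -cy -card_pairing_on ?cy //.
by apply: eq_card => sg; rewrite !inE andbT.
Qed.

(** Pairings are grouped by the family [ct] of their types on the columns. The full type is the sum
    of this family, and the size of each group is a product over the columns. *)
Lemma sum_pairings_by_column_types (S : finType) p q (i : S ->
  'I_p) (c : S -> 'I_q)
    (a : 'M[nat]_(p, q)) (g : 'M[nat]_p -> R) :
  (forall x y, a x y = #|[set s | (i s == x) && (c s == y)]|) ->
  \sum_(sg | pairing_on [set: S] sg && compatible c sg) g (pairing_type i [set:
    S] sg)
  = \sum_(r \in mx_pair_types a)
      (\prod_k #|[set tau | pairing_on (fiber c k) tau
                            && (pairing_type i (fiber c k) tau == r k)]|)%N%:R
      * g (total_type r).
Proof.
move=> aE; rewrite (fsbig_finite _ _ (finite_mx_pair_types a)) /=.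
pose ct (sg : {perm S}) : {ffun 'I_q -> 'M[nat]_p} :=
  [ffun k => pairing_type i (fiber c k) sg].
transitivity (\sum_(sg : {perm S} | pairing_on [set: S] sg && compatible c sg)
    \sum_(r <- finmap.enum_fset (fset_set (mx_pair_types a)))
      (if ct sg == r then g (total_type r) else 0)).
  apply: eq_bigr => sg /andP[psg csg].
  have cta : ct sg \in finmap.enum_fset (fset_set (mx_pair_types a)).
    apply: etrans (in_fset_set (finite_mx_pair_types a) (ct sg)) _.
    by apply/mem_set => k; rewrite ffunE; exact: fiber_pair_types.
  rewrite (bigD1_seq (ct sg)) //= ?finmap.fset_uniq // eqxx big1 ?addr0 =>
    [|r /negPf rn].
    congr g; rewrite (pairing_type_fibers i c) /total_type.
    by apply: eq_bigr => k _; rewrite ffunE.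
  by rewrite eq_sym rn.
rewrite exchange_big /=; apply: eq_bigr => r _.
rewrite -big_mkcondr /= sumr_const -[LHS]mulr_natl; congr (_%:R * _).
have := @card_pairings_fiberwise S q c (fun k sg =>
  pairing_type i (fiber c k) sg == r k).
move=> /(_ (fun k sg tau e => congr1 (eq_op^~ (r k)) (eq_pairing_type i e))) <-.
apply: eq_card => sg; rewrite !inE unfold_in /= andbA; congr (_ && _).
apply/eqP/forallP => [<- k|H]; first by rewrite ffunE.
by apply/ffunP => k; rewrite ffunE; apply/eqP; exact: H.
Qed.

End MainIdentity.

Theorem theorem2p7 (R : realType) (n p q : nat)
    (mu : probability (borel_mx R n) R) (mu_haar : is_haar mu)
    (a : 'M[nat]_(p, q)) (le_pn : (p <= n)%N) (le_qn : (q <= n)%N)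
    (le_En : forall r : {ffun 'I_q -> 'M[nat]_p},
       mx_pair_types a r -> (size (Ecols r) <= n)%N) :
  Jint mu a = \sum_(r \in mx_pair_types a) Kcoef' a r * Jint mu (Emx r).
Proof.
(* The points are tagged by their column, and within a column they are the consecutive points used
   by [Kcoef], with the block index as row label. *)
pose T_ (k : 'I_q) := 'I_(\sum_i col k a i ord0); pose S := {k : 'I_q & T_ k}.
pose i (s : S) : 'I_p := block_index (tagged s); pose c (s : S) : 'I_q := tag s.
have injT k : injective (fun w : T_ k => Tagged T_ w : S).
  by move=> w w' /eqP; rewrite eq_Tagged => /eqP.
have fibE k : [set Tagged T_ w | w in [set: T_ k]]%SET = fiber c k.
  apply/setP => s; rewrite inE; apply/imsetP/eqP => [[w _ ->] //|].
  by case: s => k' w /= e; rewrite /c /= in e; subst k'; exists w; rewrite ?inE.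
have aE x y : a x y = #|[set s | (i s == x) && (c s == y)]%SET|.
  have -> : a x y = col y a x ord0 by rewrite mxE.
  rewrite -card_block -(card_imset _ (injT y)); apply: eq_card => s.
  rewrite [RHS]inE; apply/imsetP/andP => [[w wx ->]|[]].
    by rewrite -block_indexE wx.
  case: s => y' w /= wx /eqP e; rewrite /c /= in e; subst y'; exists w => //.
  by rewrite block_indexE.
have [g gE] := Iint_pairing_types mu_haar le_pn i.
have rowa x : #|[set s | i s == x]%SET| = (\sum_y a x y)%N.
  rewrite -sum1_card (partition_big c predT) //=; apply: eq_bigr => y _.
  by rewrite aE -sum1_card; apply: eq_bigl => s; rewrite !inE.
have rowr r : mx_pair_types a r -> forall x,
    #|[set s | i s == x]%SET| = (\sum_l total_type r x l)%N.
  move=> ra x; rewrite rowa /total_type.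
  under [RHS]eq_bigr do rewrite summxE.
  rewrite exchange_big /=; apply: eq_bigr => y _.
  by have [_ _ ->] := ra y; rewrite mxE.
have symr r : mx_pair_types a r ->
    forall k l, total_type r k l = total_type r l k.
  move=> ra k l; rewrite /total_type !summxE; apply: eq_bigr => y _.
  by have [sy _ _] := ra y; rewrite -[in LHS]sy mxE.
have IE r : mx_pair_types a r -> Iint mu (Emx r) =
    (\prod_k \prod_l dfact (Emx r k l))%N%:R * g (total_type r).
  move=> ra; apply: (Iint_Emx gE (le_En r ra)) => [|k|];
    [exact: symr| |exact: rowr].
  rewrite /total_type summxE; elim/big_ind: _ => // [x y ex ey|y _].
    by rewrite oddD (negPf ex) (negPf ey).
  by have [_ ev _] := ra y.
have Ia : Iint mu a = \sum_(r \in mx_pair_types a)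
    (\prod_j Kcoef (col j a) (r j))%N%:R * g (total_type r).
  rewrite (gE _ _ _ le_qn aE) (sum_pairings_by_column_types g aE).
  apply: eq_fsbigr => r _; congr (_%:R * _); apply: eq_bigr => k _.
  apply/esym; apply: (Kcoef_card_pairing (injT k) (fibE k)) => w.
  by [].
(* Both matrices have the same total degree, so the same double factorial enters the normalizations
   of both integrals. *)
have sumE r : mx_pair_types a r ->
    (\sum_i \sum_j Emx r i j = \sum_i \sum_j a i j)%N.
  move=> ra; apply: eq_bigr => x _; rewrite -rowa (rowr r ra).
  rewrite -sum_Ecols_row; last exact: symr.
  by rewrite [RHS]big_tnth; apply: eq_bigr => y _; rewrite mxE.
have dn0 (m m' : nat) (b : 'M[nat]_(m, m')) :
    (\prod_i \prod_j dfact (b i j))%N%:R != 0 :> R.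
  rewrite pnatr_eq0 -lt0n prodn_gt0 // => k; rewrite prodn_gt0 // => l.
  exact: dfact_gt0.
have nn0 : (dfact (n - 1))%:R != 0 :> R by rewrite pnatr_eq0 -lt0n dfact_gt0.
(* In each term the product of double factorials of [Emx r] cancels against the normalization of its
   integral, and that of [a] gives the denominator of [Kcoef']. *)
rewrite /Jint Ia !(fsbig_finite _ _ (finite_mx_pair_types a)) /= 2!mulr_suml.
apply: eq_big_seq => r; rewrite in_fset_set; last exact: finite_mx_pair_types.
move=> /set_mem ra; rewrite (IE r ra) (sumE r ra) /Kcoef' !natrM.
have := dn0 _ _ a; have := dn0 _ _ (Emx r); move: nn0.
move: (dfact (n - 1))%:R (\prod_k \prod_l dfact (Emx r k l))%N%:R
  (\prod_i \prod_j dfact (a i j))%N%:R => x y z x0 y0 z0.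
by field; rewrite x0 y0 z0.
Qed.
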